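(* ($\mathsf{CZF}+\mathsf{Pow}+\mathsf{NDCom}$) Let $\mathcal{A}$ be a partial combinatory algebra (pca). Then $V(\mathcal{A})\models\mathsf{NDCom}$.
   Context: The logic is intuitionistic. $\mathsf{CZF}$ has axioms Extensionality, Pairing, Union, Infinity, the $\in$-Induction scheme, $\Delta_0$-Separation, Strong Collection (if $\forall x\in a\,\exists y\,\phi(x,y)$ then there is a set $b$ with $\forall x\in a\,\exists y\in b\,\phi(x,y)$ and $\forall y\in b\,\exists x\in a\,\phi(x,y)$), and Subset Collection (for all sets $a,b$ there is a set $c$ such that for all $u$, if $\forall x\in a\,\exists y\in b\,\phi(x,y,u)$ then there is $d\in c$ with $\forall x\in a\,\exists y\in d\,\phi(x,y,u)$ and $\forall y\in d\,\exists x\in a\,\phi(x,y,u)$). $\mathsf{Pow}$ is the Power Set axiom. $\mathsf{NDCom}$: $\exists x\,\forall y\,\neg[\forall z\,(\neg\neg(z\in x)\to z\in y)]$. McCarty-style realizability: the pca $\mathcal{A}$ is a set, with application written by juxtaposition, with pairing combinator $\mathbf{p}$ and projections $(e)_0,(e)_1$, and with numerals $\mathbf{0},\mathbf{1}\in\mathcal{A}$. The class $V(\mathcal{A})=\bigcup_{\alpha\in\mathrm{Ord}}V(\mathcal{A})_\alpha$, where $V(\mathcal{A})_\alpha=\bigcup_{\beta\in\alpha}\mathcal{P}(\mathcal{A}\times V(\mathcal{A})_\beta)$. For $e\in\mathcal{A}$ and parameters in $V(\mathcal{A})$ (application terms are required to be defined): $e\Vdash a\in b$ iff there is $c$ with $\langle(e)_0,c\rangle\in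 b$ and $(e)_1\Vdash a=c$; $e\Vdash a=b$ iff for all $f,d$: $\langle f,d\rangle\in a$ implies $(e)_0f\Vdash d\in b$, and $\langle f,d\rangle\in b$ implies $(e)_1f\Vdash d\in a$; $e\Vdash\phi\land\psi$ iff $(e)_0\Vdash\phi$ and $(e)_1\Vdash\psi$; $e\Vdash\phi\lor\psi$ iff ($(e)_0=\mathbf{0}$ and $(e)_1\Vdash\phi$) or ($(e)_0=\mathbf{1}$ and $(e)_1\Vdash\psi$); $e\Vdash\neg\phi$ iff no $f\in\mathcal{A}$ satisfies $f\Vdash\phi$; $e\Vdash\phi\to\psi$ iff for all $f\in\mathcal{A}$, $f\Vdash\phi$ implies $ef\Vdash\psi$; $e\Vdash\forall x\in a\,\phi(x)$ iff for all $\langle f,c\rangle\in a$, $ef\Vdash\phi(c)$; $e\Vdash\exists x\in a\,\phi(x)$ iff there is $c$ with $\langle(e)_0,c\rangle\in a$ and $(e)_1\Vdash\phi(c)$; $e\Vdash\forall x\,\phi(x)$ iff $e\Vdash\phi(c)$ for all $c\in V(\mathcal{A})$; $e\Vdash\exists x\,\phi(x)$ iff $e\Vdash\phi(c)$ for some $c\in V(\mathcal{A})$. $V(\mathcal{A})\models\phi$ means that some $e\in\mathcal{A}$ satisfies $e\Vdash\phi$. *)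

(* Defs.v *)
From Stdlib Require List.
From mathcomp Require Import ssreflect ssrfun ssrbool eqtype ssrnat seq.
Set Implicit Arguments.
Unset Strict Implicit.
Unset Printing Implicit Defensive.

(* Intuitionistic first-order logic over the language {∈, =}.  The results are
   statements about provability: NDCom refutes excluded middle, so reading the
   axioms in Prop would not be compatible with classical axioms there.

   Terms are variables, written as de Bruijn indices.  Bounded quantifiers are
   primitive, because realizability treats them separately; the bound [a] in
   [BAll a φ] and [BEx a φ] lives outside the scope of the quantifier. *)

Inductive form : Type :=
| Memb (x y : nat)
| Equ (x y : nat)
| And (φ ψ : form)
| Or (φ ψ : form)
| Imp (φ ψ : form)
| Neg (φ : form)
| All (φ : form)
| Ex (φ : form)
| BAll (a : nat) (φ : form)
| BEx (a : nat) (φ : form).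

Declare Scope form_scope.
Delimit Scope form_scope with form.
Bind Scope form_scope with form.
Notation "x ∈ y" := (Memb x y) (at level 70) : form_scope.
Notation "x ≈ y" := (Equ x y) (at level 70) : form_scope.
Notation "¬ φ" := (Neg φ) (at level 75, right associativity) : form_scope.
Notation "φ ∧ ψ" := (And φ ψ) (at level 80, right associativity) : form_scope.
Notation "φ ∨ ψ" := (Or φ ψ) (at level 85, right associativity) : form_scope.
Notation "φ ⇒ ψ" := (Imp φ ψ) (at level 90, right associativity) : form_scope.
Notation "φ ⇔ ψ" := (And (Imp φ ψ) (Imp ψ φ)) (at level 91) : form_scope.
Notation "∀' φ" := (All φ) (at level 95, right associativity) : form_scope.
Notation "∃' φ" := (Ex φ) (at level 95, right associativity) : form_scope.
Notation "∀[ a ] φ" := (BAll a φ)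
  (at level 95, right associativity, format "∀[ a ]  φ") : form_scope.
Notation "∃[ a ] φ" := (BEx a φ)
  (at level 95, right associativity, format "∃[ a ]  φ") : form_scope.
Local Open Scope form_scope.

Definition scons (T : Type) (x : T) (ρ : nat -> T) (n : nat) : T :=
  if n is m.+1 then ρ m else x.

Definition up (ρ : nat -> nat) : nat -> nat := scons 0 (fun n => (ρ n).+1).

Fixpoint ren (ρ : nat -> nat) (φ : form) : form :=
  match φ with
  | Memb x y => Memb (ρ x) (ρ y)
  | Equ x y => Equ (ρ x) (ρ y)
  | And φ ψ => And (ren ρ φ) (ren ρ ψ)
  | Or φ ψ => Or (ren ρ φ) (ren ρ ψ)
  | Imp φ ψ => Imp (ren ρ φ) (ren ρ ψ)
  | Neg φ => Neg (ren ρ φ)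
  | All φ => All (ren (up ρ) φ)
  | Ex φ => Ex (ren (up ρ) φ)
  | BAll a φ => BAll (ρ a) (ren (up ρ) φ)
  | BEx a φ => BEx (ρ a) (ren (up ρ) φ)
  end.

(* Substitution of t for the variable 0. *)
Definition subst1 (t : nat) (φ : form) : form := ren (scons t id) φ.

(* Natural deduction from the axioms T and the hypotheses Γ.  The rules for All
   and Ex shift Γ but not T, so an axiom with free variables stands for its
   universal closure. *)
Inductive prf (T : form -> Prop) : seq form -> form -> Prop :=
| Ax Γ φ : T φ -> prf T Γ φ
| Hyp Γ φ : List.In φ Γ -> prf T Γ φ
| AndI Γ φ ψ : prf T Γ φ -> prf T Γ ψ -> prf T Γ (φ ∧ ψ)
| AndE1 Γ φ ψ : prf T Γ (φ ∧ ψ) -> prf T Γ φ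
| AndE2 Γ φ ψ : prf T Γ (φ ∧ ψ) -> prf T Γ ψ
| OrI1 Γ φ ψ : prf T Γ φ -> prf T Γ (φ ∨ ψ)
| OrI2 Γ φ ψ : prf T Γ ψ -> prf T Γ (φ ∨ ψ)
| OrE Γ φ ψ χ :
    prf T Γ (φ ∨ ψ) -> prf T (φ :: Γ) χ -> prf T (ψ :: Γ) χ -> prf T Γ χ
| ImpI Γ φ ψ : prf T (φ :: Γ) ψ -> prf T Γ (φ ⇒ ψ)
| ImpE Γ φ ψ : prf T Γ (φ ⇒ ψ) -> prf T Γ φ -> prf T Γ ψ
| NegI Γ φ ψ : prf T (φ :: Γ) ψ -> prf T (φ :: Γ) (¬ ψ) -> prf T Γ (¬ φ)
| NegE Γ φ ψ : prf T Γ (¬ φ) -> prf T Γ φ -> prf T Γ ψ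
| AllI Γ φ : prf T (map (ren S) Γ) φ -> prf T Γ (∀' φ)
| AllE Γ φ t : prf T Γ (∀' φ) -> prf T Γ (subst1 t φ)
| ExI Γ φ t : prf T Γ (subst1 t φ) -> prf T Γ (∃' φ)
| ExE Γ φ ψ :
    prf T Γ (∃' φ) -> prf T (φ :: map (ren S) Γ) (ren S ψ) -> prf T Γ ψ
| BAllI Γ a φ :
    prf T ((0 ∈ a.+1) :: map (ren S) Γ) φ -> prf T Γ (∀[a] φ)
| BAllE Γ a φ t :
    prf T Γ (∀[a] φ) -> prf T Γ (t ∈ a) -> prf T Γ (subst1 t φ)
| BExI Γ a φ t :
    prf T Γ (t ∈ a) -> prf T Γ (subst1 t φ) -> prf T Γ (∃[a] φ)
| BExE Γ a φ ψ :
    prf T Γ (∃[a] φ) ->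
    prf T (φ :: (0 ∈ a.+1) :: map (ren S) Γ) (ren S ψ) -> prf T Γ ψ
| EquI Γ x : prf T Γ (x ≈ x)
| EquE Γ φ x y :
    prf T Γ (x ≈ y) -> prf T Γ (subst1 x φ) -> prf T Γ (subst1 y φ).

Definition provable (T : form -> Prop) (φ : form) : Prop := prf T [::] φ.

Fixpoint delta0 (φ : form) : bool :=
  match φ with
  | Memb _ _ | Equ _ _ => true
  | And φ ψ | Or φ ψ | Imp φ ψ => delta0 φ && delta0 ψ
  | Neg φ | BAll _ φ | BEx _ φ => delta0 φ
  | All _ | Ex _ => false
  end.

(* [inst xs k φ]: the variables 0, ..., size xs - 1 of φ become xs, and the
   remaining variables (the parameters of a scheme) start at index k. *)
Definition inst (xs : seq nat) (k : nat) (φ : form) : form :=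
  ren (foldr (@scons nat) (fun n => k + n) xs) φ.

Definition is_succ (u v : nat) : form := ∀' 0 ∈ u.+1 ⇔ 0 ∈ v.+1 ∨ 0 ≈ v.+1.

Definition extensionality : form :=
  ∀' ∀' (∀' 0 ∈ 2 ⇔ 0 ∈ 1) ⇒ 1 ≈ 0.

Definition pairing : form :=
  ∀' ∀' ∃' ∀' 0 ∈ 1 ⇔ 0 ≈ 3 ∨ 0 ≈ 2.

Definition union : form :=
  ∀' ∃' ∀' 0 ∈ 1 ⇔ (∃[2] 1 ∈ 0).

Definition infinity : form :=
  ∃' ∀' 0 ∈ 1 ⇔ (∀' ¬ 0 ∈ 1) ∨ (∃[1] is_succ 1 0).

(* φ(x) with x = 0 *)
Definition set_induction (φ : form) : form :=
  (∀' (∀[0] inst [:: 0] 2 φ) ⇒ φ) ⇒ ∀' φ.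

(* φ(y) with y = 0 *)
Definition separation (φ : form) : form :=
  ∀' ∃' ∀' 0 ∈ 1 ⇔ 0 ∈ 2 ∧ inst [:: 0] 3 φ.

(* φ(x, y) with x = 0, y = 1 *)
Definition strong_collection (φ : form) : form :=
  ∀' (∀[0] ∃' inst [:: 1; 0] 3 φ) ⇒
  ∃' (∀[1] ∃[1] inst [:: 1; 0] 4 φ) ∧ (∀[0] ∃[2] inst [:: 0; 1] 4 φ).

(* φ(x, y, u) with x = 0, y = 1, u = 2; a, b, c, u are quantified in this order *)
Definition subset_collection (φ : form) : form :=
  ∀' ∀' ∃' ∀' (∀[3] ∃[3] inst [:: 1; 0; 2] 6 φ) ⇒
  ∃[1] (∀[4] ∃[1] inst [:: 1; 0; 3] 7 φ) ∧ (∀[0] ∃[5] inst [:: 0; 1; 3] 7 φ).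

Inductive CZF : form -> Prop :=
| CZF_extensionality : CZF extensionality
| CZF_pairing : CZF pairing
| CZF_union : CZF union
| CZF_infinity : CZF infinity
| CZF_set_induction φ : CZF (set_induction φ)
| CZF_separation φ : delta0 φ -> CZF (separation φ)
| CZF_strong_collection φ : CZF (strong_collection φ)
| CZF_subset_collection φ : CZF (subset_collection φ).

Definition Pow : form := ∀' ∃' ∀' 0 ∈ 1 ⇔ (∀[0] 0 ∈ 3).

Definition NDCom : form := ∃' ∀' ¬ ∀' ¬ ¬ 0 ∈ 2 ⇒ 0 ∈ 1.

Inductive CZF_Pow_NDCom : form -> Prop :=
| base_CZF φ : CZF φ -> CZF_Pow_NDCom φ
| base_Pow : CZF_Pow_NDCom Pow
| base_NDCom : CZF_Pow_NDCom NDCom.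

(* w = {a, b} *)
Definition is_upair (w a b : nat) : form :=
  a ∈ w ∧ b ∈ w ∧ (∀[w] 0 ≈ a.+1 ∨ 0 ≈ b.+1).

(* w = ⟨a, b⟩ = {{a}, {a, b}} *)
Definition is_pair (w a b : nat) : form :=
  ∃[w] ∃[w.+1] is_upair 1 a.+2 a.+2 ∧ is_upair 0 a.+2 b.+2 ∧ is_upair w.+2 1 0.

(* w = ⟨⟨a, b⟩, c⟩; the bound variables range over the Kuratowski components *)
Definition is_triple (w a b c : nat) : form :=
  ∃[w] ∃[0] is_pair 0 a.+2 b.+2 ∧ is_pair w.+2 0 c.+2.

(* ⟨a, b⟩ ∈ r and ⟨⟨a, b⟩, c⟩ ∈ r *)
Definition pair_in (r a b : nat) : form := ∃[r] is_pair 0 a.+1 b.+1.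
Definition triple_in (r a b c : nat) : form := ∃[r] is_triple 0 a.+1 b.+1 c.+1.

Definition is_trans (a : nat) : form := ∀[a] ∀[0] 0 ∈ a.+2.
Definition is_ord (a : nat) : form := is_trans a ∧ (∀[a] is_trans 0).

(* f is a function with domain a *)
Definition is_fun_on (f a : nat) : form :=
  (∀[f] ∃[a.+1] ∃' is_pair 2 1 0) ∧
  (∀[a] ∃' pair_in f.+2 1 0 ∧ (∀' pair_in f.+3 2 0 ⇒ 0 ≈ 1)).

(* The variables denoting the carrier, the graph of application, the pairing
   and projection combinators, and the numerals 0 and 1. *)
Record pca_vars : Type := PcaVars {
  car : nat; ap : nat; pr : nat; pr0 : nat; pr1 : nat; num0 : nat; num1 : nat }.

Definition shift_pca (k : nat) (P : pca_vars) : pca_vars :=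
  PcaVars (k + car P) (k + ap P) (k + pr P) (k + pr0 P) (k + pr1 P)
          (k + num0 P) (k + num1 P).
Notation "P ↑ k" := (shift_pca k P) (at level 30, k at level 0).

(* e f is defined and equal to r *)
Definition app (P : pca_vars) (e f r : nat) : form := triple_in (ap P) e f r.

(* e f is defined and its value, the variable 0 of φ, satisfies φ *)
Definition let_app (P : pca_vars) (e f : nat) (φ : form) : form :=
  ∃[car P] app (P↑1) e.+1 f.+1 0 ∧ φ.

(* The same for (e)_0 and (e)_1. *)
Definition let_fst (P : pca_vars) (e : nat) (φ : form) : form :=
  let_app P (pr0 P) e φ.
Definition let_snd (P : pca_vars) (e : nat) (φ : form) : form :=
  let_app P (pr1 P) e φ.

(* Application is a partial binary operation on the carrier. *)
Definition is_partial_op (P : pca_vars) : form :=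
  let A := car P in
  (∀[ap P] ∃[A.+1] ∃[A.+2] ∃[A.+3] is_triple 3 2 1 0) ∧
  (∀[A] ∀[A.+1] ∀[A.+2] ∀[A.+3]
     app (P↑4) 3 2 1 ⇒ app (P↑4) 3 2 0 ⇒ 1 ≈ 0).

(* k a b = a *)
Definition is_k (P : pca_vars) (k : nat) : form :=
  let A := car P in
  ∀[A] ∀[A.+1] let_app (P↑2) k.+2 1 (app (P↑3) 0 1 2).

(* s a b is defined, and s a b c ≃ (a c) (b c) *)
Definition is_s (P : pca_vars) (s : nat) : form :=
  let A := car P in
  ∀[A] ∀[A.+1]
    let_app (P↑2) s.+2 1 (let_app (P↑3) 0 1
      (∀[A.+4] ∀[A.+4.+1]
         app (P↑6) 2 1 0 ⇔
         let_app (P↑6) 5 1 (let_app (P↑7) 5 2 (app (P↑8) 1 0 2)))).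

(* p0 (p a b) = a and p1 (p a b) = b *)
Definition is_pairing (P : pca_vars) : form :=
  let A := car P in
  ∀[A] ∀[A.+1]
    let_app (P↑2) (pr P).+2 1 (let_app (P↑3) 0 1
      (app (P↑4) (pr0 P).+4 0 3 ∧ app (P↑4) (pr1 P).+4 0 2)).

(* d 0 a b = a and d 1 a b = b *)
Definition is_case (P : pca_vars) (d : nat) : form :=
  let A := car P in
  ∀[A] ∀[A.+1]
    let_app (P↑2) d.+2 (num0 P).+2
      (let_app (P↑3) 0 2 (app (P↑4) 0 2 3)) ∧
    let_app (P↑2) d.+2 (num1 P).+2
      (let_app (P↑3) 0 2 (app (P↑4) 0 2 2)).

(* The case combinator is all that is required of the numerals 0 and 1, so that
   every usual coding of numerals is covered. *)
Definition is_pca (P : pca_vars) : form :=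
  let A := car P in
  is_partial_op P ∧ (∃[A] is_k (P↑1) 0) ∧ (∃[A] is_s (P↑1) 0) ∧
  (pr P ∈ A ∧ pr0 P ∈ A ∧ pr1 P ∈ A ∧ is_pairing P) ∧
  (num0 P ∈ A ∧ num1 P ∈ A ∧ (∃[A] is_case (P↑1) 0)).

(* x ⊆ A × u *)
Definition sub_prod (P : pca_vars) (x u : nat) : form :=
  ∀[x] ∃[(car P).+1] ∃[u.+2] is_pair 2 1 0.

(* x ∈ ⋃_{β ∈ c} 𝒫(A × f(β)) *)
Definition in_level (P : pca_vars) (f c x : nat) : form :=
  ∃[c] ∃' pair_in f.+2 1 0 ∧ sub_prod (P↑2) x.+2 0.

(* f is the function γ ↦ V(A)_γ on a *)
Definition level_fun (P : pca_vars) (f a : nat) : form :=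
  is_fun_on f a ∧
  (∀[a] ∀' pair_in f.+2 1 0 ⇒ ∀' 0 ∈ 1 ⇔ in_level (P↑3) f.+3 2 0).

(* x ∈ V(A): for some ordinal α, x ∈ V(A)_α = ⋃_{β ∈ α} 𝒫(A × V(A)_β) *)
Definition in_V (P : pca_vars) (x : nat) : form :=
  ∃' is_ord 0 ∧ (∃' level_fun (P↑2) 0 1 ∧ in_level (P↑2) 0 1 x.+2).

(* Realizability of the atomic formulas is defined by simultaneous recursion.
   The recursion is carried out by set-sized approximations: R holds of
   (e, a, b), for a and b in the transitive set T, iff e ⊩ a = b. *)

(* e ⊩ a ∈ b, with ⊩ on equalities given by R *)
Definition rmem_step (P : pca_vars) (R e a b : nat) : form :=
  ∃' let_fst (P↑1) e.+1 (pair_in b.+2 0 1) ∧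
     let_snd (P↑1) e.+1 (triple_in R.+2 0 a.+2 1).

(* ⟨f, d⟩ ∈ a implies (q e) f ⊩ d ∈ b, for a projection q *)
Definition rsub_step (P : pca_vars) (q R e a b : nat) : form :=
  ∀' ∀' pair_in a.+2 1 0 ⇒
    let_app (P↑2) q.+2 e.+2 (let_app (P↑3) 0 2
      (rmem_step (P↑4) R.+4 0 2 b.+4)).

Definition req_step (P : pca_vars) (R e a b : nat) : form :=
  rsub_step P (pr0 P) R e a b ∧ rsub_step P (pr1 P) R e b a.

(* If ⟨f, d⟩ ∈ a ∈ T then d ∈ T since T is transitive, so the recursive calls
   stay within T. *)
Definition approx (P : pca_vars) (T R : nat) : form :=
  is_trans T ∧
  (∀[car P] ∀[T.+1] ∀[T.+2]
     triple_in R.+3 2 1 0 ⇔ req_step (P↑3) R.+3 2 1 0).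

(* e ⊩ a = b *)
Definition req (P : pca_vars) (e a b : nat) : form :=
  ∃' ∃' approx (P↑2) 1 0 ∧ a.+2 ∈ 1 ∧ b.+2 ∈ 1 ∧ triple_in 0 e.+2 a.+2 b.+2.

(* e ⊩ a ∈ b *)
Definition rmem (P : pca_vars) (e a b : nat) : form :=
  ∃' let_fst (P↑1) e.+1 (pair_in b.+2 0 1) ∧
     let_snd (P↑1) e.+1 (req (P↑2) 0 a.+2 1).

Definition shift_env (k : nat) (σ : nat -> nat) : nat -> nat :=
  fun n => k + σ n.

(* e ⊩ φ; the free variable n of φ is interpreted by the variable σ n *)
Fixpoint realizes (P : pca_vars) (e : nat) (σ : nat -> nat) (φ : form) : form :=
  match φ with
  | Memb x y => rmem P e (σ x) (σ y)
  | Equ x y => req P e (σ x) (σ y)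
  | And φ ψ =>
      let_fst P e (realizes (P↑1) 0 (shift_env 1 σ) φ) ∧
      let_snd P e (realizes (P↑1) 0 (shift_env 1 σ) ψ)
  | Or φ ψ =>
      (let_fst P e (0 ≈ (num0 P).+1) ∧
       let_snd P e (realizes (P↑1) 0 (shift_env 1 σ) φ)) ∨
      (let_fst P e (0 ≈ (num1 P).+1) ∧
       let_snd P e (realizes (P↑1) 0 (shift_env 1 σ) ψ))
  | Imp φ ψ =>
      ∀[car P] realizes (P↑1) 0 (shift_env 1 σ) φ ⇒
        let_app (P↑1) e.+1 0 (realizes (P↑2) 0 (shift_env 2 σ) ψ)
  | Neg φ => ¬ ∃[car P] realizes (P↑1) 0 (shift_env 1 σ) φ
  | All φ => ∀' in_V (P↑1) 0 ⇒ realizes (P↑1) e.+1 (up σ) φ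
  | Ex φ => ∃' in_V (P↑1) 0 ∧ realizes (P↑1) e.+1 (up σ) φ
  | BAll x φ =>
      ∀' ∀' pair_in (σ x).+2 1 0 ⇒
        let_app (P↑2) e.+2 1
          (realizes (P↑3) 0 (scons 1 (shift_env 3 σ)) φ)
  | BEx x φ =>
      ∃' let_fst (P↑1) e.+1 (pair_in (σ x).+2 0 1) ∧
         let_snd (P↑1) e.+1
           (realizes (P↑2) 0 (scons 1 (shift_env 2 σ)) φ)
  end.

(* V(A) ⊨ φ *)
Definition V_models (P : pca_vars) (φ : form) : form :=
  ∃[car P] realizes (P↑1) 0 (shift_env 1 id) φ.

(* The universal quantification over all pcas. *)
Definition for_all_pca (φ : pca_vars -> form) : form :=
  let P := PcaVars 6 5 4 3 2 1 0 in
  ∀' ∀' ∀' ∀' ∀' ∀' ∀' is_pca P ⇒ φ P.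

(* Main.v *)
From Stdlib Require List.
From mathcomp Require Import ssreflect ssrfun ssrbool eqtype ssrnat seq.
Require Import Defs.
Set Implicit Arguments.
Unset Strict Implicit.
Unset Printing Implicit Defensive.
Local Open Scope form_scope.

(** Let [x] be a set whose double complement [{z : ¬¬ z ∈ x}] is contained in no
    set.  The witness inside the universe of names is a code [a] of [x]: a
    hereditarily tagged copy, in which each element is paired with one fixed
    element [e] of the pca.  The proof compares two translations.

    From sets to names, every [z] has a code in V(A) ([coding_ex]), and [e]
    realizes the equality of any two codes of the same set ([approx_ex]).  This
    works because the tag and the realizer can be the same element: for
    [u = s p (s k k)] and [e = p u u], the application [u e] is the pair [v] of
    [e] with itself.  So both projections of [e] send the only tag [e] to [v],
    whose first projection is a tag and whose second projection is a realizer
    of equality, and [v] realizes that a code of an element of [x] belongs to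
    [a] ([tag_ex], [realizes_mem]).

    From names to sets, forgetting the tags decodes every set [b], by the
    recursion that decodes [b] to the set of the decoded [d] with [⟨f, d⟩ ∈ b]
    ([decodable_all]), and sets that are realizably equal decode to the same set,
    by set induction and Extensionality ([eq_realized_decode]).

    Now let [f] realize [∀z (¬¬ z ∈ a → z ∈ b)] and let [Y] be the decoding of
    [b].  If [¬¬ z ∈ x] and [c] is a code of [z], then [c ∈ a] is not not
    realized, so every element of the pca realizes [¬¬ c ∈ a], and [f e] realizes
    [c ∈ b].  Hence [c] is realizably equal to some [d] with a tag in [b], which
    gives [z ∈ Y].  So [Y] contains the double complement of [x], which is
    absurd ([NDCom_realized]).

    Neither translation is built as a recursive function.  A decoding is a set
    of pairs that satisfies the recursion clause at each of its members; such
    sets are closed under unions, so they can be collected.  The relation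
    [e ⊩ a = b] on a transitive set is the greatest fixed point of its defining
    operator, which exists by Power Set ([gfp_ex]); the coinduction principle of
    the greatest fixed point yields the equality of codes.  That codes lie in V(A)
    requires the functions [γ ↦ V(A)_γ] on all ordinals, which are glued by
    Collection ([level_fun_ex], [in_V_intro]).

    The derivations are produced in the manner of Kripke semantics: a context is
    a world, an implication is introduced by passing to a larger context, and a
    universal quantifier by proving all instances with names ([generic_name]). *)

(** * Renaming, weakening and generic_name names *)

Lemma up_ext (ρ τ : nat -> nat) : ρ =1 τ -> up ρ =1 up τ.
Proof. by move=> E [|n] //=; rewrite E. Qed.

Lemma ren_ext φ : forall ρ τ, ρ =1 τ -> ren ρ φ = ren τ φ.
Proof.
elim: φ => [x y|x y|φ IH ψ IH'|φ IH ψ IH'|φ IH ψ IH'|φ IH|φ IH|φ IH|a φ IH|a φ IH] ρ τ E /=;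
  by rewrite ?E ?(IH _ _ E) ?(IH' _ _ E) ?(IH _ _ (up_ext E)).
Qed.

Lemma ren_ren φ : forall ρ τ, ren ρ (ren τ φ) = ren (ρ \o τ) φ.
Proof.
have U ρ τ : up ρ \o up τ =1 up (ρ \o τ) by case.
elim: φ => [x y|x y|φ IH ψ IH'|φ IH ψ IH'|φ IH ψ IH'|φ IH|φ IH|φ IH|a φ IH|a φ IH] ρ τ /=;
  by rewrite ?IH ?IH' ?(ren_ext _ (U _ _)).
Qed.

Lemma ren_id φ : forall ρ, ρ =1 id -> ren ρ φ = φ.
Proof.
have U ρ : ρ =1 id -> up ρ =1 id by move=> E [|n] //=; rewrite E.
elim: φ => [x y|x y|φ IH ψ IH'|φ IH ψ IH'|φ IH ψ IH'|φ IH|φ IH|φ IH|a φ IH|a φ IH] ρ E /=;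
  by rewrite ?E ?(IH _ E) ?(IH' _ E) ?(IH _ (U _ E)).
Qed.

Lemma ren_subst1 ρ t φ : ren ρ (subst1 t φ) = subst1 (ρ t) (ren (up ρ) φ).
Proof. by rewrite /subst1 !ren_ren; apply: ren_ext => -[|n]. Qed.

Lemma ren_up_S ρ φ : ren (up ρ) (ren S φ) = ren S (ren ρ φ).
Proof. by rewrite !ren_ren; apply: ren_ext. Qed.

(** The bound [N] is what makes fresh names available. *)
Lemma ren_finite φ : exists N, forall ρ τ,
  (forall n, n < N -> ρ n = τ n) -> ren ρ φ = ren τ φ.
Proof.
have M N N' (ρ τ : nat -> nat) : (forall n, n < maxn N N' -> ρ n = τ n) ->
  (forall n, n < N -> ρ n = τ n) /\ (forall n, n < N' -> ρ n = τ n).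
  by move=> E; split=> n l; apply: E; rewrite leq_max l ?orbT.
have U N (ρ τ : nat -> nat) : (forall n, n < N -> ρ n = τ n) -> forall n, n < N -> up ρ n = up τ n.
  by move=> E [|n] l //=; rewrite E // ltnW.
elim: φ => [x y|x y|φ [N IH] ψ [N' IH']|φ [N IH] ψ [N' IH']|φ [N IH] ψ [N' IH']
           |φ [N IH]|φ [N IH]|φ [N IH]|a φ [N IH]|a φ [N IH]];
  try (by exists (maxn N N') => ρ τ /M[E E'] /=; rewrite (IH _ _ E) (IH' _ _ E'));
  try (by exists (maxn x.+1 y.+1) => ρ τ /M[E E'] /=; rewrite E ?E');
  try (by exists N => ρ τ E /=; rewrite (IH _ _ E));
  try (by exists N => ρ τ E /=; rewrite (IH _ _ (U _ _ _ E)));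
  by exists (maxn a.+1 N) => ρ τ /M[E E'] /=; rewrite E // (IH _ _ (U _ _ _ E')).
Qed.

Lemma ren_finite_seq (Γ : seq form) : exists N, forall ρ τ,
  (forall n, n < N -> ρ n = τ n) -> map (ren ρ) Γ = map (ren τ) Γ.
Proof.
elim: Γ => [|φ Γ [N IH]]; first by exists 0.
have [N' IH'] := ren_finite φ; exists (maxn N N') => ρ τ E /=.
by rewrite (IH ρ τ) ?(IH' ρ τ) // => n l; apply: E; rewrite leq_max l ?orbT.
Qed.

Lemma delta0_ren φ : forall ρ, delta0 (ren ρ φ) = delta0 φ.
Proof. by elim: φ => //= φ IH ψ IH' ρ; rewrite IH IH'. Qed.

Definition sub (Γ Δ : seq form) := forall φ, List.In φ Γ -> List.In φ Δ.

Lemma sub_cons φ Γ : sub Γ (φ :: Γ). Proof. by right. Qed.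
Lemma sub_cons2 φ Γ Δ : sub Γ Δ -> sub (φ :: Γ) (φ :: Δ).
Proof. by move=> s ψ [->|/s]; [left|right]. Qed.
Lemma sub_trans Γ Δ E : sub Γ Δ -> sub Δ E -> sub Γ E.
Proof. by move=> s s' φ /s /s'. Qed.
Lemma In_map (f : form -> form) φ Γ : List.In φ Γ -> List.In (f φ) (map f Γ).
Proof. by elim: Γ => //= ψ Γ IH [->|/IH]; [left|right]. Qed.
Lemma sub_map f Γ Δ : sub Γ Δ -> sub (map f Γ) (map f Δ).
Proof.
elim: Γ => [|ψ Γ IH] s φ //= [<-|H]; first by apply/In_map/s; left.
by apply: IH H => ξ H; apply: s; right.
Qed.

Lemma weak T Γ Δ φ : sub Γ Δ -> prf T Γ φ -> prf T Δ φ.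
Proof.
move=> s H; elim: H Δ s => {Γ φ}.
- by move=> Γ φ ? Δ s; apply: Ax.
- by move=> Γ φ i Δ s; apply/Hyp/s.
- by move=> Γ φ ψ _ I1 _ I2 Δ s; apply: AndI; auto.
- by move=> Γ φ ψ _ I1 Δ s; apply: AndE1; apply: I1.
- by move=> Γ φ ψ _ I1 Δ s; apply: AndE2; apply: I1.
- by move=> Γ φ ψ _ I1 Δ s; apply: OrI1; auto.
- by move=> Γ φ ψ _ I1 Δ s; apply: OrI2; auto.
- by move=> Γ φ ψ χ _ I1 _ I2 _ I3 Δ s; apply: OrE (I1 _ s) (I2 _ _) (I3 _ _); exact: sub_cons2.
- by move=> Γ φ ψ _ I1 Δ s; apply/ImpI/I1/sub_cons2.
- by move=> Γ φ ψ _ I1 _ I2 Δ s; apply: ImpE (I1 _ s) (I2 _ s).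
- by move=> Γ φ ψ _ I1 _ I2 Δ s; apply: NegI (I1 _ _) (I2 _ _); apply: sub_cons2.
- by move=> Γ φ ψ _ I1 _ I2 Δ s; apply: NegE (I1 _ s) (I2 _ s).
- by move=> Γ φ _ I1 Δ s; apply/AllI/I1/sub_map.
- by move=> Γ φ t _ I1 Δ s; apply/AllE/I1.
- by move=> Γ φ t _ I1 Δ s; apply: ExI; apply: I1 s.
- by move=> Γ φ ψ _ I1 _ I2 Δ s; apply: ExE (I1 _ s) (I2 _ _); apply/sub_cons2/sub_map.
- by move=> Γ a φ _ I1 Δ s; apply/BAllI/I1/sub_cons2/sub_map.
- by move=> Γ a φ t _ I1 _ I2 Δ s; apply: BAllE (I1 _ s) (I2 _ s).
- by move=> Γ a φ t _ I1 _ I2 Δ s; apply: BExI (I1 _ s) (I2 _ s).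
- by move=> Γ a φ ψ _ I1 _ I2 Δ s; apply: BExE (I1 _ s) (I2 _ _); apply/sub_cons2/sub_cons2/sub_map.
- by move=> Γ x Δ s; apply: EquI.
- by move=> Γ φ x y _ I1 _ I2 Δ s; apply: EquE (I1 _ s) (I2 _ s).
Qed.

Lemma prf_ren (T : form -> Prop) ρ Γ φ : (forall τ ψ, T ψ -> T (ren τ ψ)) ->
  prf T Γ φ -> prf T (map (ren ρ) Γ) (ren ρ φ).
Proof.
move=> HT.
have mapS τ Δ : map (ren (up τ)) (map (ren S) Δ) = map (ren S) (map (ren τ) Δ).
  by rewrite -!map_comp; apply: eq_map => ψ /=; apply: ren_up_S.
move=> H; elim: H ρ => {Γ φ} /=.
- by move=> Γ φ ? ρ; apply/Ax/HT.
- by move=> Γ φ i ρ; apply/Hyp/In_map.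
- by move=> Γ φ ψ _ I1 _ I2 ρ; apply: AndI; auto.
- by move=> Γ φ ψ _ I1 ρ; apply: AndE1; apply: I1.
- by move=> Γ φ ψ _ I1 ρ; apply: AndE2; apply: I1.
- by move=> Γ φ ψ _ I1 ρ; apply: OrI1; auto.
- by move=> Γ φ ψ _ I1 ρ; apply: OrI2; auto.
- by move=> Γ φ ψ χ _ I1 _ I2 _ I3 ρ; apply: OrE (I1 ρ) (I2 ρ) (I3 ρ).
- by move=> Γ φ ψ _ I1 ρ; apply/ImpI/I1.
- by move=> Γ φ ψ _ I1 _ I2 ρ; apply: ImpE (I1 ρ) (I2 ρ).
- by move=> Γ φ ψ _ I1 _ I2 ρ; apply: NegI (I1 ρ) (I2 ρ).
- by move=> Γ φ ψ _ I1 _ I2 ρ; apply: NegE (I1 ρ) (I2 ρ).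
- by move=> Γ φ _ I1 ρ; apply: AllI; rewrite -mapS; apply: I1.
- by move=> Γ φ t _ I1 ρ; rewrite ren_subst1; apply/AllE/I1.
- by move=> Γ φ t _ I1 ρ; apply: (@ExI _ _ _ (ρ t)); rewrite -ren_subst1; apply: I1.
- move=> Γ φ ψ _ I1 _ I2 ρ; apply: ExE (I1 ρ) _.
  by rewrite -mapS -ren_up_S; apply: I2.
- by move=> Γ a φ _ I1 ρ; apply: BAllI; rewrite -mapS; apply: (I1 (up ρ)).
- by move=> Γ a φ t _ I1 _ I2 ρ; rewrite ren_subst1; apply: BAllE (I1 ρ) (I2 ρ).
- move=> Γ a φ t _ I1 _ I2 ρ; apply: (@BExI _ _ _ _ (ρ t)) (I1 ρ) _.
  by rewrite -ren_subst1; apply: I2.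
- move=> Γ a φ ψ _ I1 _ I2 ρ; apply: BExE (I1 ρ) _.
  by rewrite -mapS -ren_up_S; apply: (I2 (up ρ)).
- by move=> Γ x ρ; apply: EquI.
- by move=> Γ φ x y _ I1 _ I2 ρ; rewrite ren_subst1; apply: EquE (I1 ρ) _;
  rewrite -ren_subst1; apply: I2.
Qed.

(** A renaming of an instance of a scheme is the instance for the renamed formula,
    whose schematic variables are kept fixed by [up]. *)
Lemma axiom_ren ρ φ : CZF_Pow_NDCom φ -> CZF_Pow_NDCom (ren ρ φ).
Proof.
case=> [{}φ||].
- case=> [||||ψ|ψ D|ψ|ψ]; try by do 2 constructor.
  + rewrite (_ : ren _ _ = set_induction (ren (up ρ) ψ)); first by do 2 constructor.
    by rewrite /set_induction /inst /= !ren_ren;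
      congr (All (BAll _ _ ⇒ _) ⇒ _); apply: ren_ext => -[|n].
  + rewrite (_ : ren _ _ = separation (ren (up ρ) ψ)); first by do 2 constructor; rewrite delta0_ren.
    rewrite /separation /inst /= !ren_ren.
    congr (All (Ex (All (And (Imp _ (_ ∧ _)) (Imp (_ ∧ _) _))))); by apply: ren_ext => -[|n].
  + rewrite (_ : ren _ _ = strong_collection (ren (up (up ρ)) ψ)); first by do 2 constructor.
    rewrite /strong_collection /inst /= !ren_ren; 
    congr (All (BAll _ (Ex _) ⇒ Ex (BAll _ (BEx _ _) ∧ BAll _ (BEx _ _))));
    by apply: ren_ext => -[|[|n]].
  + rewrite (_ : ren _ _ = subset_collection (ren (up (up (up ρ))) ψ)); first by do 2 constructor.
    rewrite /subset_collection /inst /= !ren_ren; congr (All (All (Ex (All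
      (BAll _ (BEx _ _) ⇒ (BEx _ (BAll _ (BEx _ _) ∧ BAll _ (BEx _ _))))))));
    by apply: ren_ext => -[|[|[|n]]].
- exact: base_Pow.
- exact: base_NDCom.
Qed.

Notation "Γ ⊢ φ" := (prf CZF_Pow_NDCom Γ φ) (at level 97, φ at level 96).

(** It is enough to use the instance at a name [M] that is free neither in [Γ] nor
    in [φ]: renaming [M] to 0 and all other names to their successors gives the
    premise of [AllI]. *)
Lemma generic_name Γ φ : (forall n, Γ ⊢ subst1 n φ) -> map (ren S) Γ ⊢ φ.
Proof.
have [N FΓ] := ren_finite_seq Γ; have [N' Fφ] := ren_finite φ.
pose M := maxn N N'.
move=> /(_ M) /(prf_ren (fun i => if i == M then 0 else i.+1) axiom_ren).
have -> : map (ren (fun i => if i == M then 0 else i.+1)) Γ = map (ren S) Γ.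
  by apply: FΓ => n l; rewrite ltn_eqF // leq_max l.
rewrite /subst1 ren_ren (Fφ _ id) ?ren_id // => -[|n] l /=; first by rewrite eqxx.
by rewrite ltn_eqF // leq_max (ltnW l) orbT.
Qed.

(** * Rules with names in place of binders *)

(** The eliminations are in continuation-passing form, because a context that
    proves a disjunction or an existential statement need not prove a disjunct or
    an instance. *)
Section Rules.
Variable Γ : seq form.

Lemma allI φ : (forall n, Γ ⊢ subst1 n φ) -> Γ ⊢ ∀' φ.
Proof. by move=> /generic_name /AllI. Qed.

Lemma impI φ ψ : (forall Δ, sub Γ Δ -> Δ ⊢ φ -> Δ ⊢ ψ) -> Γ ⊢ φ ⇒ ψ.
Proof. by move=> H; apply/ImpI/H; [exact: sub_cons|apply: Hyp; left]. Qed.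

(** As [x ≈ x] is provable for every [x], this formula implies every formula. *)
Definition Bot := ¬ 0 ≈ 0.

Lemma negI φ : (forall Δ, sub Γ Δ -> Δ ⊢ φ -> Δ ⊢ Bot) -> Γ ⊢ ¬ φ.
Proof.
by move=> H; apply: NegI (EquI _ _ 0) (H _ _ _); [exact: sub_cons|apply: Hyp; left].
Qed.

Lemma negE {φ} ψ : Γ ⊢ ¬ φ -> Γ ⊢ φ -> Γ ⊢ ψ.
Proof. exact: NegE. Qed.

Lemma andE φ ψ : (Γ ⊢ φ ∧ ψ) <-> (Γ ⊢ φ) /\ (Γ ⊢ ψ).
Proof. by split=> [H|[]]; [split; [apply: AndE1 H|apply: AndE2 H]|apply: AndI]. Qed.

Lemma orE φ ψ χ : Γ ⊢ φ ∨ ψ -> (forall Δ, sub Γ Δ -> Δ ⊢ φ -> Δ ⊢ χ) ->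
  (forall Δ, sub Γ Δ -> Δ ⊢ ψ -> Δ ⊢ χ) -> Γ ⊢ χ.
Proof.
by move=> H H1 H2; apply: OrE H (H1 _ _ _) (H2 _ _ _); (exact: sub_cons || (apply: Hyp; left)).
Qed.

Lemma exE φ χ : Γ ⊢ ∃' φ -> (forall Δ, sub Γ Δ -> forall n, Δ ⊢ subst1 n φ -> Δ ⊢ χ) -> Γ ⊢ χ.
Proof.
move=> H1 H2; have: Γ ⊢ ∀' φ ⇒ ren S χ.
  apply: allI => n; rewrite /subst1 /= ren_ren [ren _ χ]ren_id //; apply: impI => Δ s H.
  exact: H2 H.
move=> H; apply: (ExE H1).
have := prf_ren S axiom_ren H; move=> /(weak (@sub_cons φ _)) /(@AllE _ _ _ 0).
rewrite /subst1 /= !ren_ren [ren _ φ]ren_id; last by case.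
rewrite (@ren_ext χ _ S) // => /ImpE; apply.
by apply: Hyp; left.
Qed.

Lemma ballI a φ : (forall n Δ, sub Γ Δ -> Δ ⊢ n ∈ a -> Δ ⊢ subst1 n φ) -> Γ ⊢ ∀[a] φ.
Proof.
move=> H; apply: BAllI; have: Γ ⊢ ∀' 0 ∈ a.+1 ⇒ φ.
  by apply: allI => n; apply: impI => Δ s; apply: H.
move=> /(prf_ren S axiom_ren) /= /(weak (@sub_cons (0 ∈ a.+1) _)) /(@AllE _ _ _ 0).
rewrite /subst1 /= ren_ren ren_id; last by case.
by move=> /ImpE; apply; apply: Hyp; left.
Qed.

Lemma bexE a φ χ : Γ ⊢ ∃[a] φ ->
  (forall Δ, sub Γ Δ -> forall n, Δ ⊢ n ∈ a -> Δ ⊢ subst1 n φ -> Δ ⊢ χ) -> Γ ⊢ χ.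
Proof.
move=> H1 H2; apply: (@exE (0 ∈ a.+1 ∧ φ)) => [|Δ s n H]; last exact: H2 s n (AndE1 H) (AndE2 H).
apply: (BExE H1) => /=; apply: (@ExI _ _ _ 0); rewrite /subst1 /= ren_ren ren_id; last by case.
by apply: AndI; apply: Hyp; [right; left|left].
Qed.

End Rules.

(** After a step to a larger context, [world] transports all derivations among the
    hypotheses to it, and gives it the name of the old context if that is no longer
    in use. *)
Ltac lift s :=
  lazymatch type of s with sub ?Γ ?Δ =>
    repeat match goal with H : prf _ Γ _ |- _ => apply (weak s) in H end;
    try (clear s Γ; rename Δ into Γ)
  end.
Ltac world := let Δ := fresh "Δ" in let s := fresh "s" in intros Δ s; lift s.

(** * Auxiliary notions and their renaming *)

Definition is_union u a := ∀' 0 ∈ u.+1 ⇔ (∃[a.+1] 1 ∈ 0).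
Definition is_adj c a b := ∀' 0 ∈ c.+1 ⇔ 0 ∈ a.+1 ∨ 0 ≈ b.+1.
Definition subset a b := ∀[a] 0 ∈ b.+1.

(** An upper bound of the product of [a] and [b] is enough, as it is only used to
    bound Separation; the same holds for the other bounding notions below. *)
Definition has_pairs W a b := ∀[a] ∀[b.+1] ∀' is_pair 0 2 1 ⇒ 0 ∈ W.+3.
Definition has_triples W A T := ∀[A] ∀[T.+1] ∀[T.+2] ∀' is_triple 0 3 2 1 ⇒ 0 ∈ W.+4.
Definition field_bound D B := ∀' ∀' pair_in B.+2 1 0 ⇒ 1 ∈ D.+2 ∧ 0 ∈ D.+2.
Definition agree f f' c := ∀[c] ∀' ∀' pair_in f.+3 2 1 ⇒ pair_in f'.+3 2 0 ⇒ 1 ≈ 0.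
Definition total f c := ∀[c] ∃' pair_in f.+2 1 0.

(** [u = V(A)_β]; a level function on [β] determines this value, because
    [V(A)_β] depends only on the levels below [β]. *)
Definition is_level P β u :=
  ∃' level_fun (P↑1) 0 β.+1 ∧ (∀' 0 ∈ u.+2 ⇔ in_level (P↑2) 1 β.+2 0).

(** The recursion clause [z = {B(d) : ⟨f, d⟩ ∈ c}] of decoding, read for a relation
    [B] instead of a function. *)
Definition decode_step B c z :=
  (∀' ∀' pair_in c.+2 1 0 ⇒ ∃[z.+2] pair_in B.+3 1 0) ∧
  (∀[z] ∃' ∃' pair_in c.+3 1 0 ∧ pair_in B.+3 0 2).
Definition decoding B := ∀' ∀' pair_in B.+2 1 0 ⇒ decode_step B.+2 1 0.

(** If [B] is also a decoding, then the members of its first components are again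
    such components, so the tag [e] is the only one hereditarily. *)
Definition canonical P e B :=
  ∀' ∀' pair_in B.+2 1 0 ⇒ in_V (P↑2) 1 ∧ ∀[1] ∃' is_pair 1 e.+4 0.
Definition coding P e B := decoding B ∧ canonical P e B.
Definition decodable b := ∃' ∃' decoding 0 ∧ pair_in 0 b.+2 1.

(** The following versions of [rmem_step], [rsub_step] and [req_step] have their
    quantifiers bounded by [T], so that Separation applies to them. *)
Definition rmem_in P T R e a b :=
  ∃[T] let_fst (P↑1) e.+1 (pair_in b.+2 0 1) ∧
       let_snd (P↑1) e.+1 (triple_in R.+2 0 a.+2 1).
Definition rsub_in P T q R e a b :=
  ∀[T] ∀[T.+1] pair_in a.+2 1 0 ⇒
    let_app (P↑2) q.+2 e.+2 (let_app (P↑3) 0 2 (rmem_in (P↑4) T.+4 R.+4 0 2 b.+4)).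
Definition req_in P T R e a b := rsub_in P T (pr0 P) R e a b ∧ rsub_in P T (pr1 P) R e b a.
Definition post_fixed P T R :=
  ∀[car P] ∀[T.+1] ∀[T.+2] triple_in R.+3 2 1 0 ⇒ req_in (P↑3) T.+3 R.+3 2 1 0.
Definition fixed_pt P T R :=
  ∀[car P] ∀[T.+1] ∀[T.+2] triple_in R.+3 2 1 0 ⇔ req_in (P↑3) T.+3 R.+3 2 1 0.
Definition below P T R R' :=
  ∀[car P] ∀[T.+1] ∀[T.+2] triple_in R.+3 2 1 0 ⇒ triple_in R'.+3 2 1 0.

(** For names whose only tag is [e], the realizer [e] sends the tag to [v] on either
    side of an equality, and [v] returns the tag together with the realizer [e]. *)
Definition self_tag P e u v := e ∈ car P ∧ u ∈ car P ∧ v ∈ car P ∧ app P (pr0 P) e u ∧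
  app P (pr1 P) e u ∧ app P u e v ∧ app P (pr0 P) v e ∧ app P (pr1 P) v e.

(** Either order is allowed, which makes the relation symmetric without a
    combinator that realizes the symmetry of equality. *)
Definition eq_realized A R c d := ∃[A] triple_in R.+1 0 c.+1 d.+1 ∨ triple_in R.+1 0 d.+1 c.+1.

Definition ren_pca (ρ : nat -> nat) (P : pca_vars) :=
  PcaVars (ρ (car P)) (ρ (ap P)) (ρ (pr P)) (ρ (pr0 P)) (ρ (pr1 P)) (ρ (num0 P)) (ρ (num1 P)).

(** These equations hold by computation; rewriting with them, instead of
    computing, keeps the notions folded.  The proof is transparent because a
    multirule is searched much faster when its components are visible. *)
Lemma ren_defs (ρ : nat -> nat) :
  ((forall w a b, ren ρ (is_upair w a b) = is_upair (ρ w) (ρ a) (ρ b)) *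
  (forall w a b, ren ρ (is_pair w a b) = is_pair (ρ w) (ρ a) (ρ b)) *
  (forall w a b c, ren ρ (is_triple w a b c) = is_triple (ρ w) (ρ a) (ρ b) (ρ c)) *
  (forall w a b, ren ρ (pair_in w a b) = pair_in (ρ w) (ρ a) (ρ b)) *
  (forall w a b c, ren ρ (triple_in w a b c) = triple_in (ρ w) (ρ a) (ρ b) (ρ c)) *
  (forall a, ren ρ (is_trans a) = is_trans (ρ a)) *
  (forall a, ren ρ (is_ord a) = is_ord (ρ a)) *
  (forall f a, ren ρ (is_fun_on f a) = is_fun_on (ρ f) (ρ a)) *
  (forall u a, ren ρ (is_union u a) = is_union (ρ u) (ρ a)) *
  (forall c a b, ren ρ (is_adj c a b) = is_adj (ρ c) (ρ a) (ρ b)) *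
  (forall a b, ren ρ (subset a b) = subset (ρ a) (ρ b)) *
  (forall P e f r, ren ρ (app P e f r) = app (ren_pca ρ P) (ρ e) (ρ f) (ρ r)) *
  (forall P e f φ, ren ρ (let_app P e f φ) =
     let_app (ren_pca ρ P) (ρ e) (ρ f) (ren (up ρ) φ)) *
  (forall P x u, ren ρ (sub_prod P x u) = sub_prod (ren_pca ρ P) (ρ x) (ρ u)) *
  (forall P f c x, ren ρ (in_level P f c x) = in_level (ren_pca ρ P) (ρ f) (ρ c) (ρ x)) *
  (forall P f a, ren ρ (level_fun P f a) = level_fun (ren_pca ρ P) (ρ f) (ρ a)) *
  (forall P x, ren ρ (in_V P x) = in_V (ren_pca ρ P) (ρ x)) *
  (forall P R e a b, ren ρ (rmem_step P R e a b) =
     rmem_step (ren_pca ρ P) (ρ R) (ρ e) (ρ a) (ρ b)) *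
  (forall P q R e a b, ren ρ (rsub_step P q R e a b) =
     rsub_step (ren_pca ρ P) (ρ q) (ρ R) (ρ e) (ρ a) (ρ b)) *
  (forall P R e a b, ren ρ (req_step P R e a b) =
     req_step (ren_pca ρ P) (ρ R) (ρ e) (ρ a) (ρ b)) *
  (forall P T R, ren ρ (approx P T R) = approx (ren_pca ρ P) (ρ T) (ρ R)) *
  (forall P e a b, ren ρ (req P e a b) = req (ren_pca ρ P) (ρ e) (ρ a) (ρ b)) *
  (forall P e a b, ren ρ (rmem P e a b) = rmem (ren_pca ρ P) (ρ e) (ρ a) (ρ b)))%type.
Proof. by do !split. Defined.

Lemma ren_aux (ρ : nat -> nat) :
  ((forall f f' c, ren ρ (agree f f' c) = agree (ρ f) (ρ f') (ρ c)) *
  (forall f c, ren ρ (total f c) = total (ρ f) (ρ c)) *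
  (forall P β u, ren ρ (is_level P β u) = is_level (ren_pca ρ P) (ρ β) (ρ u)) *
  (forall B c z, ren ρ (decode_step B c z) = decode_step (ρ B) (ρ c) (ρ z)) *
  (forall B, ren ρ (decoding B) = decoding (ρ B)) *
  (forall P e B, ren ρ (canonical P e B) = canonical (ren_pca ρ P) (ρ e) (ρ B)) *
  (forall P e B, ren ρ (coding P e B) = coding (ren_pca ρ P) (ρ e) (ρ B)) *
  (forall b, ren ρ (decodable b) = decodable (ρ b)) *
  (forall P e u v, ren ρ (self_tag P e u v) =
     self_tag (ren_pca ρ P) (ρ e) (ρ u) (ρ v)) *
  (forall A R c d, ren ρ (eq_realized A R c d) = eq_realized (ρ A) (ρ R) (ρ c) (ρ d)) *
  (forall P T R e a b, ren ρ (rmem_in P T R e a b) =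
     rmem_in (ren_pca ρ P) (ρ T) (ρ R) (ρ e) (ρ a) (ρ b)) *
  (forall P T q R e a b, ren ρ (rsub_in P T q R e a b) =
     rsub_in (ren_pca ρ P) (ρ T) (ρ q) (ρ R) (ρ e) (ρ a) (ρ b)) *
  (forall P T R e a b, ren ρ (req_in P T R e a b) =
     req_in (ren_pca ρ P) (ρ T) (ρ R) (ρ e) (ρ a) (ρ b)) *
  (forall P T R, ren ρ (post_fixed P T R) = post_fixed (ren_pca ρ P) (ρ T) (ρ R)) *
  (forall P T R, ren ρ (fixed_pt P T R) = fixed_pt (ren_pca ρ P) (ρ T) (ρ R)) *
  (forall P T R R', ren ρ (below P T R R') = below (ren_pca ρ P) (ρ T) (ρ R) (ρ R')))%type.
Proof. by do !split. Defined.

Ltac rs := rewrite /subst1;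
  repeat progress (cbn [ren up scons]; rewrite ?(ren_defs, ren_aux));
  cbv [ren_pca shift_pca car ap pr pr0 pr1 num0 num1 addn Nat.add up scons].

(** Introduction of [∀'], [⇒], [¬] and the bounded universal quantifier: [ai],
    [ii], [ni], [bi].  Introduction of the existential quantifiers: [exi], [bexi].
    Elimination of a hypothesis that unfolds to an existential statement or to a
    disjunction: [exd], [ord]. *)
Tactic Notation "ai" ident(n) := apply: allI; intro n; rs.
Tactic Notation "ii" := apply: impI; world.
Tactic Notation "ni" := apply: negI; world.
Tactic Notation "bi" ident(n) := apply: ballI; intro n; world; rs.
Tactic Notation "exi" constr(n) := apply: (ExI (t := n)); rs.
Tactic Notation "bexi" constr(n) := apply: (@BExI _ _ _ _ n); rs.
Tactic Notation "exd" hyp(H) ident(n) :=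
  first [apply: (exE H) | apply: (bexE H)]; clear H; world; intro n; rs.
Tactic Notation "ord" hyp(H) := apply: (orE H); clear H; world; rs.

(** * Sets, pairs and triples *)

Implicit Types Γ : seq form.

Lemma iffE Γ φ ψ : Γ ⊢ φ ⇔ ψ -> (Γ ⊢ φ) <-> (Γ ⊢ ψ).
Proof. by case/andE=> H1 H2; split; apply: ImpE. Qed.

Lemma iffI Γ φ ψ : (forall Δ, sub Γ Δ -> (Δ ⊢ φ) <-> (Δ ⊢ ψ)) -> Γ ⊢ φ ⇔ ψ.
Proof. by move=> H; apply/andE; split; apply: impI => Δ s; case: (H Δ s). Qed.

Lemma eq_sym Γ x y : Γ ⊢ x ≈ y -> Γ ⊢ y ≈ x.
Proof. by move=> H; apply: (EquE (φ := 0 ≈ x.+1) H); apply: EquI. Qed.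
Lemma eq_trans Γ x y z : Γ ⊢ x ≈ y -> Γ ⊢ y ≈ z -> Γ ⊢ x ≈ z.
Proof. by move=> H H'; apply: (EquE (φ := x.+1 ≈ 0) H' H). Qed.
Lemma eq_mem Γ x y z : Γ ⊢ x ≈ y -> Γ ⊢ x ∈ z -> Γ ⊢ y ∈ z.
Proof. by move=> H H'; apply: (EquE (φ := 0 ∈ z.+1) H H'). Qed.
Lemma mem_eq Γ x y z : Γ ⊢ x ≈ y -> Γ ⊢ z ∈ x -> Γ ⊢ z ∈ y.
Proof. by move=> H H'; apply: (EquE (φ := z.+1 ∈ 0) H H'). Qed.

Lemma set_ext Γ a b : (forall n Δ, sub Γ Δ -> (Δ ⊢ n ∈ a) <-> (Δ ⊢ n ∈ b)) -> Γ ⊢ a ≈ b.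
Proof.
move=> H; have E : Γ ⊢ extensionality by apply/Ax/base_CZF/CZF_extensionality.
apply: (ImpE (AllE b (AllE a E))); ai n; apply: iffI => Δ s; exact: H.
Qed.

Lemma set_ind Γ φ :
  (forall z Δ, sub Γ Δ -> Δ ⊢ ∀[z] φ -> Δ ⊢ subst1 z φ) -> forall z, Γ ⊢ subst1 z φ.
Proof.
move=> H z; apply: AllE.
have E : Γ ⊢ set_induction φ by apply/Ax/base_CZF/CZF_set_induction.
apply: (ImpE E); apply: allI => x; rewrite /subst1 /=; ii => IH; apply: H => //.
by move: IH; rewrite ren_ren ren_id //; case.
Qed.

Lemma separate Γ φ a χ : delta0 φ ->
  (forall Δ, sub Γ Δ -> forall s, Δ ⊢ ∀' 0 ∈ s.+1 ⇔ 0 ∈ a.+1 ∧ φ -> Δ ⊢ χ) -> Γ ⊢ χ.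
Proof.
move=> D H; have E : Γ ⊢ separation φ by apply/Ax/base_CZF/CZF_separation.
have {}E := AllE a E; move: E; rewrite /subst1 /= /inst ren_ren => E.
apply: (exE E) => Δ s n; rewrite /subst1 /= !ren_ren ren_id; last by case.
exact: H.
Qed.

Lemma setE Γ s φ n : Γ ⊢ ∀' 0 ∈ s.+1 ⇔ φ -> (Γ ⊢ n ∈ s) <-> (Γ ⊢ subst1 n φ).
Proof. by move=> H; apply: iffE; exact: (AllE n H). Qed.

Lemma sepE Γ s a φ n : Γ ⊢ ∀' 0 ∈ s.+1 ⇔ 0 ∈ a.+1 ∧ φ ->
  (Γ ⊢ n ∈ s) <-> (Γ ⊢ n ∈ a) /\ (Γ ⊢ subst1 n φ).
Proof. by move=> /(setE n) H; rewrite H; exact: andE. Qed.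

Definition swap := scons 1 (scons 0 (fun n => n.+2)).
(** The scheme numbers its two variables in the order of their names, whereas here
    [φ] numbers them from the inside, the collected set being 0. *)
Lemma collect Γ φ a χ : Γ ⊢ ∀[a] ∃' φ ->
  (forall Δ, sub Γ Δ -> forall b, Δ ⊢ ∀[a] ∃[b.+1] φ ->
     Δ ⊢ ∀[b] ∃[a.+1] ren swap φ -> Δ ⊢ χ) -> Γ ⊢ χ.
Proof.
move=> C H; have E : Γ ⊢ strong_collection (ren swap φ).
  by apply/Ax/base_CZF/CZF_strong_collection.
have {}E := AllE a E; move: E; rewrite /subst1 /= /inst !ren_ren => E.
apply: (exE (ImpE E _)) => [|Δ s n].
  by rewrite ren_id // => -[|[]].
rewrite /subst1 /= !ren_ren => /andE[H1 H2].
apply: (H _ s n).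
  by move: H1; rewrite ren_id // => -[|[]].
by move: H2; rewrite (@ren_ext _ _ swap) // => -[|[|k]].
Qed.

Lemma pairing_ex Γ a b : Γ ⊢ ∃' is_upair 0 a.+1 b.+1.
Proof.
have E : Γ ⊢ pairing by apply/Ax/base_CZF/CZF_pairing.
have {}E := AllE b (AllE a E); move: E; rs => E; exd E w => H.
exi w; apply: AndI; first by apply/(setE _ H)/OrI1/EquI.
apply: AndI; first by apply/(setE _ H)/OrI2/EquI.
by bi n => /(setE _ H).
Qed.

Lemma union_ex Γ a : Γ ⊢ ∃' is_union 0 a.+1.
Proof.
have E : Γ ⊢ union by apply/Ax/base_CZF/CZF_union.
exact: AllE a E.
Qed.

Lemma unionI Γ u a b n : Γ ⊢ is_union u a -> Γ ⊢ n ∈ b -> Γ ⊢ b ∈ a -> Γ ⊢ n ∈ u.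
Proof. by move=> H H1 H2; apply/(setE _ H); rs; bexi b. Qed.

Lemma unionE Γ u a n χ : Γ ⊢ is_union u a -> Γ ⊢ n ∈ u ->
  (forall Δ, sub Γ Δ -> forall b, Δ ⊢ b ∈ a -> Δ ⊢ n ∈ b -> Δ ⊢ χ) -> Γ ⊢ χ.
Proof. by move=> H /(setE _ H); exact: bexE. Qed.

Lemma upairE Γ w a b n : Γ ⊢ is_upair w a b -> (Γ ⊢ n ∈ w) <-> (Γ ⊢ n ≈ a ∨ n ≈ b).
Proof.
move=> /andE[Ha /andE[Hb H]]; split=> [|E]; first by move=> /(BAllE H).
by ord E => /eq_sym E; [apply: eq_mem E Ha|apply: eq_mem E Hb].
Qed.
Lemma upairl Γ w a b : Γ ⊢ is_upair w a b -> Γ ⊢ a ∈ w.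
Proof. by move=> /andE[]. Qed.
Lemma upairr Γ w a b : Γ ⊢ is_upair w a b -> Γ ⊢ b ∈ w.
Proof. by move=> /andE[_ /andE[]]. Qed.
Lemma singE Γ w a n : Γ ⊢ is_upair w a a -> Γ ⊢ n ∈ w -> Γ ⊢ n ≈ a.
Proof. by move=> /(upairE n) H /H E; ord E. Qed.

Lemma adj_ex Γ a b : Γ ⊢ ∃' is_adj 0 a.+1 b.+1.
Proof.
have E := pairing_ex Γ b b; exd E s => Hs.
have E := pairing_ex Γ a s; exd E p => Hp.
have E := union_ex Γ p; exd E u => Hu.
exi u; ai n; apply: iffI; world; split=> H.
  apply: (unionE Hu H); world; move=> c /(upairE _ Hp) C H'; ord C => C.
    by apply/OrI1/(mem_eq C).
  by apply/OrI2/(singE Hs); apply: mem_eq C H'.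
ord H => H; first exact: (unionI Hu H (upairl Hp)).
by apply: (unionI Hu _ (upairr Hp)); apply/(upairE _ Hs)/OrI1.
Qed.
Lemma adjE Γ c a b n : Γ ⊢ is_adj c a b -> (Γ ⊢ n ∈ c) <-> (Γ ⊢ n ∈ a ∨ n ≈ b).
Proof. by move=> /(setE n). Qed.
Lemma adj_l Γ c a b n : Γ ⊢ is_adj c a b -> Γ ⊢ n ∈ a -> Γ ⊢ n ∈ c.
Proof. by move=> /(adjE n) H K; apply/H/OrI1. Qed.
Lemma adj_r Γ c a b : Γ ⊢ is_adj c a b -> Γ ⊢ b ∈ c.
Proof. by move=> /(adjE b) H; apply/H/OrI2/EquI. Qed.

Lemma pow_ex Γ a : Γ ⊢ ∃' ∀' 0 ∈ 1 ⇔ subset 0 a.+2.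
Proof. have E : Γ ⊢ Pow by apply/Ax/base_Pow. exact: AllE a E. Qed.
Lemma powE Γ p a x : Γ ⊢ ∀' 0 ∈ p.+1 ⇔ subset 0 a.+1 -> (Γ ⊢ x ∈ p) <-> (Γ ⊢ subset x a).
Proof. exact: setE. Qed.

Lemma subsetE Γ a b n : Γ ⊢ subset a b -> Γ ⊢ n ∈ a -> Γ ⊢ n ∈ b.
Proof. by move=> H /(BAllE H). Qed.

Lemma pairD Γ w a b χ : Γ ⊢ is_pair w a b ->
  (forall Δ, sub Γ Δ -> forall s t, Δ ⊢ is_upair s a a -> Δ ⊢ is_upair t a b ->
     Δ ⊢ is_upair w s t -> Δ ⊢ χ) -> Γ ⊢ χ.
Proof.
move=> H K; apply: (bexE H) => Δ s x Hx H'; apply: (bexE H') => Δ' s' y; rs.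
move=> _ /andE[H1 /andE[H2 H3]]; exact: (K _ (sub_trans s s') _ _ H1 H2 H3).
Qed.

Lemma pair_ex Γ a b : Γ ⊢ ∃' is_pair 0 a.+1 b.+1.
Proof.
have E := pairing_ex Γ a a; exd E s => Hs.
have E := pairing_ex Γ a b; exd E t => Ht.
have E := pairing_ex Γ s t; exd E w => Hw.
exi w; bexi s; first exact: upairl Hw.
bexi t; first exact: upairr Hw.
by do 2![apply: AndI => //].
Qed.

Lemma pair_inj Γ w a b c d : Γ ⊢ is_pair w a b -> Γ ⊢ is_pair w c d ->
  (Γ ⊢ a ≈ c) /\ (Γ ⊢ b ≈ d).
Proof.
move=> H1 H2; have E : Γ ⊢ a ≈ c.
  apply: (pairD H1); world; move=> s t Hs Ht Hw; apply: (pairD H2); world; move=> s' t' Hs' Ht' Hw'.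
  have /(upairE _ Hw') E := upairl Hw; apply: eq_sym; ord E => /eq_sym E; apply: (singE Hs);
    apply: (mem_eq E); [exact: upairl Hs'|exact: upairl Ht'].
split=> //.
apply: (pairD H1); world; move=> s t Hs Ht Hw; apply: (pairD H2); world; move=> s' t' Hs' Ht' Hw'.
have /(upairE _ Hw') F := upairr Hw; ord F => F.
  have {}F : Γ ⊢ b ≈ a by apply: eq_trans (eq_sym E); apply: (singE Hs'); apply: mem_eq F (upairr Ht).
  apply: (eq_trans F); apply: eq_sym.
  have /(upairE _ Hw) G := upairr Hw'; ord G => G.
    by apply: (singE Hs); apply: mem_eq G (upairr Ht').
  have /(upairE _ Ht) K := mem_eq G (upairr Ht'); ord K => // K; exact: eq_trans K F.
have /(upairE _ Ht') G := mem_eq F (upairr Ht); ord G => // G.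
have /(upairE _ Ht) K := mem_eq (eq_sym F) (upairr Ht'); ord K => K; last exact: eq_sym.
exact: eq_trans G (eq_trans (eq_sym E) (eq_sym K)).
Qed.

Lemma pair_inI Γ r w a b : Γ ⊢ w ∈ r -> Γ ⊢ is_pair w a b -> Γ ⊢ pair_in r a b.
Proof. by move=> H1 H2; bexi w. Qed.
Lemma pair_in_sub Γ r r' a b : Γ ⊢ subset r r' -> Γ ⊢ pair_in r a b -> Γ ⊢ pair_in r' a b.
Proof. by move=> S H; exd H w => Hw H; apply: pair_inI H; apply: subsetE Hw. Qed.

Lemma has_pairsE Γ W a b x y w : Γ ⊢ has_pairs W a b -> Γ ⊢ x ∈ a -> Γ ⊢ y ∈ b ->
  Γ ⊢ is_pair w x y -> Γ ⊢ w ∈ W.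
Proof. by move=> H Hx Hy; apply: ImpE (AllE w (BAllE (BAllE H Hx) Hy)). Qed.

(** A pair with components in [a] and [b] is a set of subsets of [a ∪ b]. *)
Lemma has_pairs_ex Γ a b : Γ ⊢ ∃' has_pairs 0 a.+1 b.+1.
Proof.
have E := pairing_ex Γ a b; exd E p => Hp.
have E := union_ex Γ p; exd E u => Hu.
have E := pow_ex Γ u; exd E q => Hq.
have E := pow_ex Γ q; exd E W => HW.
exi W; bi x => Hx; bi y => Hy; ai w; ii => H.
have {}Hx := unionI Hu Hx (upairl Hp).
have {}Hy := unionI Hu Hy (upairr Hp).
apply: (pairD H); world; move=> s t Hs Ht Hw.
apply/(powE _ HW); bi v => /(upairE _ Hw) V; apply/(powE _ Hq); bi z => Z.
ord V => V.
  have {}V := singE Hs (mem_eq V Z); exact: eq_mem (eq_sym V) Hx.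
have /(upairE _ Ht) {}V := mem_eq V Z; ord V => V.
  exact: eq_mem (eq_sym V) Hx.
exact: eq_mem (eq_sym V) Hy.
Qed.

Lemma tripleD Γ w a b c χ : Γ ⊢ is_triple w a b c ->
  (forall Δ, sub Γ Δ -> forall x, Δ ⊢ is_pair x a b -> Δ ⊢ is_pair w x c -> Δ ⊢ χ) -> Γ ⊢ χ.
Proof.
move=> H K; apply: (bexE H) => Δ s x Hx H'; apply: (bexE H') => Δ' s' y; rs.
move=> _ /andE[H1 H2]; exact: (K _ (sub_trans s s') _ H1 H2).
Qed.

Lemma tripleI Γ x w a b c : Γ ⊢ is_pair x a b -> Γ ⊢ is_pair w x c -> Γ ⊢ is_triple w a b c.
Proof.
move=> H1 H2; apply: (pairD H2); world; move=> s t Hs Ht Hw.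
bexi s; first exact: upairl Hw.
bexi x; first exact: upairl Hs.
exact: AndI.
Qed.

Lemma triple_ex Γ a b c : Γ ⊢ ∃' is_triple 0 a.+1 b.+1 c.+1.
Proof.
have E := pair_ex Γ a b; exd E x => Hx.
have E := pair_ex Γ x c; exd E w => Hw.
exi w; exact: tripleI Hx Hw.
Qed.

Lemma triple_inj Γ w a b c a' b' c' : Γ ⊢ is_triple w a b c -> Γ ⊢ is_triple w a' b' c' ->
  [/\ Γ ⊢ a ≈ a', Γ ⊢ b ≈ b' & Γ ⊢ c ≈ c'].
Proof.
move=> H1 H2; suff /andE[? /andE[]] : Γ ⊢ a ≈ a' ∧ b ≈ b' ∧ c ≈ c' by split.
apply: (tripleD H1); world; move=> x Hx Hw; apply: (tripleD H2); world; move=> x' Hx' Hw'.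
have [E Ec] := pair_inj Hw Hw'.
have {}Hx := EquE (φ := is_pair 0 a.+1 b.+1) E Hx.
have [Ea Eb] := pair_inj Hx Hx'.
by do 2?[apply: AndI].
Qed.

Lemma triple_inI Γ r w a b c : Γ ⊢ w ∈ r -> Γ ⊢ is_triple w a b c -> Γ ⊢ triple_in r a b c.
Proof. by move=> H1 H2; bexi w. Qed.

Lemma has_triplesE Γ W A T e a b w : Γ ⊢ has_triples W A T -> Γ ⊢ e ∈ A -> Γ ⊢ a ∈ T ->
  Γ ⊢ b ∈ T -> Γ ⊢ is_triple w e a b -> Γ ⊢ w ∈ W.
Proof. by move=> H He Ha Hb; apply: ImpE (AllE w (BAllE (BAllE (BAllE H He) Ha) Hb)). Qed.

Lemma has_triples_ex Γ A T : Γ ⊢ ∃' has_triples 0 A.+1 T.+1.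
Proof.
have E := has_pairs_ex Γ A T; exd E V => HV.
have E := has_pairs_ex Γ V T; exd E W => HW.
exi W; bi e => He; bi a => Ha; bi b => Hb; ai w; ii => H.
apply: (tripleD H); world; move=> x Hx Hw.
exact: has_pairsE HW (has_pairsE HV He Ha Hx) Hb Hw.
Qed.

Lemma eq_ren Γ τ φ x y : Γ ⊢ x ≈ y ->
  Γ ⊢ ren (scons x id \o τ) φ -> Γ ⊢ ren (scons y id \o τ) φ.
Proof.
have R z : ren (scons z id \o τ) φ = subst1 z (ren τ φ) by rewrite /subst1 ren_ren.
by rewrite !R; apply: EquE.
Qed.

Definition env3 (e a b : nat) := scons b (scons a (scons e id)).

Lemma eq_env3 Γ φ e a b e' a' b' : Γ ⊢ e ≈ e' -> Γ ⊢ a ≈ a' -> Γ ⊢ b ≈ b' ->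
  Γ ⊢ ren (env3 e a b) φ -> Γ ⊢ ren (env3 e' a' b') φ.
Proof.
move=> E1 E2 E3 H.
have {}H : Γ ⊢ ren (env3 e' a b) φ.
  have := @eq_ren Γ (scons b.+1 (scons a.+1 (scons 0 S))) φ _ _ E1.
  rewrite (@ren_ext _ _ (env3 e a b)) => [/(_ H)|]; last by move=> [|[|[|n]]].
  by rewrite (@ren_ext _ _ (env3 e' a b)) // => -[|[|[|n]]].
have {}H : Γ ⊢ ren (env3 e' a' b) φ.
  have := @eq_ren Γ (scons b.+1 (scons 0 (scons e'.+1 S))) φ _ _ E2.
  rewrite (@ren_ext _ _ (env3 e' a b)) => [/(_ H)|]; last by move=> [|[|[|n]]].
  by rewrite (@ren_ext _ _ (env3 e' a' b)) // => -[|[|[|n]]].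
have := @eq_ren Γ (scons 0 (scons a'.+1 (scons e'.+1 S))) φ _ _ E3.
rewrite (@ren_ext _ _ (env3 e' a' b)) => [/(_ H)|]; last by move=> [|[|[|n]]].
by rewrite (@ren_ext _ _ (env3 e' a' b')) // => -[|[|[|n]]].
Qed.

Lemma env3E φ e a b :
  ren (scons b id) (ren (up (scons a id)) (ren (up (up (scons e id))) φ)) = ren (env3 e a b) φ.
Proof. by rewrite !ren_ren; apply: ren_ext => -[|[|[|n]]]. Qed.

Lemma triple_sepE Γ A T S θ e a b : Γ ⊢ (∀[A] ∀[T.+1] ∀[T.+2] triple_in S.+3 2 1 0 ⇔ θ) ->
  Γ ⊢ e ∈ A -> Γ ⊢ a ∈ T -> Γ ⊢ b ∈ T ->
  (Γ ⊢ triple_in S e a b) <-> (Γ ⊢ ren (env3 e a b) θ).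
Proof.
move=> H He Ha Hb; apply: iffE.
by have := BAllE (BAllE (BAllE H He) Ha) Hb; rewrite /subst1 /= env3E.
Qed.

(** Separation by a condition on the three components instead of on the triple. *)
Lemma triple_sep Γ W A T θ χ : delta0 θ -> Γ ⊢ has_triples W A T ->
  (forall Δ, sub Γ Δ -> forall S, Δ ⊢ subset S W ->
    Δ ⊢ (∀[A] ∀[T.+1] ∀[T.+2] triple_in S.+3 2 1 0 ⇔ θ) -> Δ ⊢ χ) -> Γ ⊢ χ.
Proof.
move=> D HW K.
apply: (@separate Γ (∃[A.+1] ∃[T.+2] ∃[T.+3] is_triple 3 2 1 0 ∧ ren (up (up (up S))) θ) W).
  by rewrite /= delta0_ren.
move=> Δ s S HS; apply: (K Δ s S); first by bi w => /(sepE _ HS)[].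
have {}HW := weak s HW; clear K s Γ; rename Δ into Γ.
bi e => He; bi a => Ha; bi b => Hb.
rewrite !ren_ren (@ren_ext θ _ (env3 e a b)); last by case=> [|[|[|n]]].
apply: iffI; world; split=> H.
- exd H w => /(sepE _ HS) [_ {}H] Hw; move: H; rs => H.
  exd H e' => He' H; exd H a' => Ha' H; exd H b' => Hb' /andE[H1 H2].
  have [E1 E2 E3] := triple_inj H1 Hw.
  apply: (eq_env3 E1 E2 E3); move: H2; rewrite !ren_ren.
  by rewrite (@ren_ext θ _ (env3 e' a' b')) // => -[|[|[|n]]].
- have E := triple_ex Γ e a b; exd E w => Hw.
  apply: (triple_inI _ Hw); apply/(sepE _ HS); split; first exact: has_triplesE HW He Ha Hb Hw.
  rs; bexi e => //; bexi a => //; bexi b => //.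
  apply: AndI => //.
  by rewrite !ren_ren (@ren_ext θ _ (env3 e a b)) // => -[|[|[|n]]].
Qed.

Lemma trans_mem Γ T a b : Γ ⊢ is_trans T -> Γ ⊢ a ∈ b -> Γ ⊢ b ∈ T -> Γ ⊢ a ∈ T.
Proof. by move=> H Ha Hb; exact: BAllE (BAllE H Hb) Ha. Qed.

Lemma trans_pair Γ T w a b : Γ ⊢ is_trans T -> Γ ⊢ w ∈ T -> Γ ⊢ is_pair w a b ->
  (Γ ⊢ a ∈ T) /\ (Γ ⊢ b ∈ T).
Proof.
move=> HT Hw H; apply/andE; apply: (pairD H); world; move=> s t Hs Ht Hst.
have {}Ht' := trans_mem HT (upairr Hst) Hw.
by apply: AndI; apply: trans_mem HT _ Ht'; [exact: upairl Ht|exact: upairr Ht].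
Qed.

Lemma trans_pair_in Γ T r a b : Γ ⊢ is_trans T -> Γ ⊢ r ∈ T -> Γ ⊢ pair_in r a b ->
  (Γ ⊢ a ∈ T) /\ (Γ ⊢ b ∈ T).
Proof.
move=> HT Hr H; apply/andE; exd H w => Hw H.
by have [? ?] := trans_pair HT (trans_mem HT Hw Hr) H; apply: AndI.
Qed.

(** Transitive sets around the elements of [x] are collected; their union, with [x]
    added, is transitive. *)
Lemma trans_closure Γ x : Γ ⊢ ∃' is_trans 0 ∧ x.+1 ∈ 0.
Proof.
apply: (@set_ind Γ (∃' is_trans 0 ∧ 1 ∈ 0)) => {}x; world=> IH; rs.
apply: (collect IH); world=> D; rs => H1 H2.
have E := union_ex Γ D; exd E U => HU.
have E := adj_ex Γ U x; exd E T => HT.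
exi T; apply: AndI; last exact: adj_r HT.
bi n => /(adjE _ HT) Hn; bi m => Hm; apply: (adj_l HT).
ord Hn => Hn.
  apply: (unionE HU Hn); world; move=> T' HT' Hn'.
  have E := BAllE H2 HT'; move: E; rs => E; exd E y => Hy /andE[T1 _].
  exact: unionI HU (trans_mem T1 Hm Hn') HT'.
have {}Hm := mem_eq Hn Hm.
have E := BAllE H1 Hm; exd E T' => HT' /andE[_ Hm'].
exact: unionI HU Hm' HT'.
Qed.

Lemma trans_closure2 Γ a b : Γ ⊢ ∃' is_trans 0 ∧ a.+1 ∈ 0 ∧ b.+1 ∈ 0.
Proof.
have E := pairing_ex Γ a b; exd E p => Hp.
have E := trans_closure Γ p; exd E T => /andE[HT H].
exi T; do 2![apply: AndI => //]; apply: trans_mem HT _ H; [exact: upairl Hp|exact: upairr Hp].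
Qed.

Lemma field_boundE Γ D B a b : Γ ⊢ field_bound D B -> Γ ⊢ pair_in B a b ->
  (Γ ⊢ a ∈ D) /\ (Γ ⊢ b ∈ D).
Proof. by move=> H H'; have /andE := ImpE (AllE b (AllE a H)) H'. Qed.

Lemma field_bound_union Γ B U D : Γ ⊢ is_union U B -> Γ ⊢ is_union D U -> Γ ⊢ field_bound D B.
Proof.
move=> HU HD; ai a; ai b; ii => H; exd H w => Hw H.
apply: (pairD H); world; move=> s t Hs Ht Hst.
have Ht' := unionI HU (upairr Hst) Hw.
by apply: AndI; apply: (unionI HD _ Ht'); [exact: upairl Ht|exact: upairr Ht].
Qed.

Lemma field_bound_ex Γ B : Γ ⊢ ∃' field_bound 0 B.+1.
Proof.
have E := union_ex Γ B; exd E U => HU.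
have E := union_ex Γ U; exd E D => HD.
exi D; exact: field_bound_union HU HD.
Qed.

(** * Ordinals *)

Lemma ord_mem Γ α β : Γ ⊢ is_ord α -> Γ ⊢ β ∈ α -> Γ ⊢ is_ord β.
Proof.
case/andE=> T H Hβ; apply: AndI; first exact: (BAllE H Hβ).
bi γ => Hγ; exact: (BAllE H (trans_mem T Hγ Hβ)).
Qed.

Lemma ord_union Γ u D : Γ ⊢ is_union u D -> Γ ⊢ ∀[D] is_ord 0 -> Γ ⊢ is_ord u.
Proof.
move=> HU HD; apply: AndI.
- bi n => Hn; bi m => Hm; apply: (unionE HU Hn); world; move=> α Hα Hn'.
  have /andE[T _] := BAllE HD Hα; exact: unionI HU (trans_mem T Hm Hn') Hα.
- bi n => Hn; apply: (unionE HU Hn); world; move=> α Hα Hn'.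
  have /andE[_ H] := BAllE HD Hα; exact: (BAllE H Hn').
Qed.

Lemma ord_succ Γ a b : Γ ⊢ is_ord b -> Γ ⊢ is_adj a b b -> Γ ⊢ is_ord a.
Proof.
case/andE=> T H HA; apply: AndI.
- bi n => /(adjE _ HA) Hn; bi m => Hm; apply: (adj_l HA); ord Hn => Hn; first exact: trans_mem T Hm Hn.
  exact: (mem_eq Hn Hm).
- bi n => /(adjE _ HA) Hn; ord Hn => Hn; first exact: (BAllE H Hn).
  exact: (EquE (φ := is_trans 0) (eq_sym Hn) T).
Qed.

(** * Decodings *)

Lemma pair_in_union Γ U D a b χ : Γ ⊢ is_union U D -> Γ ⊢ pair_in U a b ->
  (forall Δ, sub Γ Δ -> forall r, Δ ⊢ r ∈ D -> Δ ⊢ pair_in r a b -> Δ ⊢ χ) -> Γ ⊢ χ.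
Proof.
move=> HU H K; apply: (bexE H) => Δ s w Hw; rs => H1; have {}HU := weak s HU.
apply: (unionE HU Hw) => Δ' s' r Hr Hw'; apply: (K _ (sub_trans s s') r Hr).
exact: pair_inI Hw' (weak s' H1).
Qed.

Lemma pair_in_adj Γ B' B p c z a b : Γ ⊢ is_adj B' B p -> Γ ⊢ is_pair p c z ->
  Γ ⊢ pair_in B' a b -> Γ ⊢ pair_in B a b ∨ (c ≈ a ∧ z ≈ b).
Proof.
move=> HA Hp H; exd H w => /(adjE _ HA) Hw H; ord Hw => Hw.
  by apply/OrI1/(pair_inI Hw).
apply/OrI2; apply/andE; apply: (pair_inj (w := p)) => //.
exact: (EquE (φ := is_pair 0 a.+1 b.+1) Hw H).
Qed.

Lemma decode_fwd Γ B c z f d : Γ ⊢ decoding B -> Γ ⊢ pair_in B c z -> Γ ⊢ pair_in c f d ->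
  Γ ⊢ ∃[z] pair_in B.+1 d.+1 0.
Proof.
move=> H Hc Hd; have /andE[K _] := ImpE (AllE z (AllE c H)) Hc.
exact: (ImpE (AllE d (AllE f K)) Hd).
Qed.

Lemma decode_bwd Γ B c z y : Γ ⊢ decoding B -> Γ ⊢ pair_in B c z -> Γ ⊢ y ∈ z ->
  Γ ⊢ ∃' ∃' pair_in c.+2 1 0 ∧ pair_in B.+2 0 y.+2.
Proof.
by move=> H Hc; have /andE[_ K] := ImpE (AllE z (AllE c H)) Hc; exact: BAllE K.
Qed.

Lemma decode_step_mono Γ B B' c z : Γ ⊢ subset B B' -> Γ ⊢ decode_step B c z -> Γ ⊢ decode_step B' c z.
Proof.
move=> S /andE[H1 H2]; apply: AndI.
- ai f; ai d; ii => H; have E := ImpE (AllE d (AllE f H1)) H; exd E y => Hy E.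
  by bexi y => //; apply: pair_in_sub S E.
- bi y => Hy; have E := BAllE H2 Hy; exd E f => E; exd E d => /andE[E1 E2].
  by exi f; exi d; apply: AndI => //; apply: pair_in_sub S E2.
Qed.

Lemma adj_subset Γ c a b : Γ ⊢ is_adj c a b -> Γ ⊢ subset a c.
Proof. by move=> H; bi x => /(adj_l H). Qed.

Lemma union_subset Γ u a b : Γ ⊢ is_union u a -> Γ ⊢ b ∈ a -> Γ ⊢ subset b u.
Proof. by move=> H Hb; bi x => Hx; apply: unionI H Hx Hb. Qed.

Lemma decoding_union Γ U D : Γ ⊢ is_union U D -> Γ ⊢ ∀[D] decoding 0 -> Γ ⊢ decoding U.
Proof.
move=> HU HD; ai c; ai z; ii => H; apply: (pair_in_union HU H); world; move=> B HB {}H.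
exact: decode_step_mono (union_subset HU HB) (ImpE (AllE z (AllE c (BAllE HD HB))) H).
Qed.

Lemma decoding_adj Γ B' B p c z : Γ ⊢ decoding B -> Γ ⊢ decode_step B c z ->
  Γ ⊢ is_pair p c z -> Γ ⊢ is_adj B' B p -> Γ ⊢ decoding B'.
Proof.
move=> HB H Hp HA; ai c'; ai z'; ii => H'; apply: (decode_step_mono (adj_subset HA)).
have {H'}E := pair_in_adj HA Hp H'; ord E => [H'|/andE[E1 E2]].
  exact: (ImpE (AllE z' (AllE c' HB)) H').
apply: (EquE (φ := decode_step B.+1 c'.+1 0) E2).
exact: (EquE (φ := decode_step B.+1 0 z.+1) E1 H).
Qed.

(** Decodings of the members of [D] are collected into one decoding [B]; the set
    [Y] of the values of [B] at the second components of [b] makes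
    [B ∪ {⟨b, Y⟩}] a decoding of [b]. *)
Lemma decodable_step Γ b D : Γ ⊢ field_bound D b -> Γ ⊢ ∀[D] decodable 0 -> Γ ⊢ decodable b.
Proof.
move=> HD IH.
have C : Γ ⊢ ∀[D] ∃' decoding 0 ∧ ∃' pair_in 1 2 0.
  bi d => Hd; have E := BAllE IH Hd; exd E z => E; exd E B => /andE[H1 H2].
  by exi B; apply: AndI => //; exi z.
apply: (collect C); world=> S; rs=> H1 H2.
have E := union_ex Γ S; exd E B => HB.
have DB : Γ ⊢ decoding B.
  by apply: (decoding_union HB); bi B' => Hb; have E := BAllE H2 Hb; exd E d => _ /andE[].
have E := field_bound_ex Γ B; exd E F => HF.
apply: (@separate Γ (∃[D.+1] ∃[D.+2] pair_in b.+3 1 0 ∧ pair_in B.+3 0 2) F) => //; world=> Y HY.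
have E := pair_ex Γ b Y; exd E p => Hp.
have E := adj_ex Γ B p; exd E B' => HB'.
exi Y; exi B'; apply: AndI; last exact: pair_inI (adj_r HB') Hp.
apply: (decoding_adj DB _ Hp HB'); apply: AndI.
- ai e; ai d; ii => H; have [He Hd] := field_boundE HD H.
  have E := BAllE H1 Hd; exd E B0 => Hb0 /andE[_ E]; exd E z => Hz.
  have {}Hz := pair_in_sub (union_subset HB Hb0) Hz.
  bexi z => //; apply/(sepE _ HY); split; first by case: (field_boundE HF Hz).
  by rs; bexi e => //; bexi d => //; apply: AndI.
- bi y => /(sepE _ HY)[_]; rs => H; exd H e => He H; exd H d => Hd H.
  by exi e; exi d.
Qed.

(** The components of the pairs in [b] are elements of elements of elements of [b], so
    set induction is applied to a statement that also speaks of the two levels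
    below its subject. *)
Lemma decodable_all Γ b : Γ ⊢ decodable b.
Proof.
suff H : Γ ⊢ decodable b ∧ (∀[b] decodable 0) ∧ (∀[b] ∀[0] decodable 0) by exact: AndE1 H.
apply: (@set_ind Γ (decodable 0 ∧ (∀[0] decodable 0) ∧ (∀[0] ∀[0] decodable 0))) => {}b; world=> IH; rs.
have H1 : Γ ⊢ ∀[b] decodable 0 by bi x => Hx; exact: AndE1 (BAllE IH Hx).
have H2 : Γ ⊢ ∀[b] ∀[0] decodable 0 by bi x => Hx; exact: AndE1 (AndE2 (BAllE IH Hx)).
do 2?[apply: AndI => //].
have E := union_ex Γ b; exd E U => HU.
have E := union_ex Γ U; exd E D => HD.
apply: (decodable_step (field_bound_union HU HD)); bi d => Hd.
apply: (unionE HD Hd); world; move=> s Hs Hds; apply: (unionE HU Hs); world; move=> w Hw Hsw.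
exact: (BAllE (BAllE (AndE2 (AndE2 (BAllE IH Hw))) Hsw) Hds).
Qed.

Section Realizability.
Variables A ap pr q0 q1 m0 m1 : nat.
Local Notation P := (PcaVars A ap pr q0 q1 m0 m1).

(** * The levels of the universe of names *)

Lemma agreeE Γ f f' c β v v' : Γ ⊢ agree f f' c -> Γ ⊢ β ∈ c ->
  Γ ⊢ pair_in f β v -> Γ ⊢ pair_in f' β v' -> Γ ⊢ v ≈ v'.
Proof. by move=> H Hβ Hv Hv'; exact: (ImpE (ImpE (AllE v' (AllE v (BAllE H Hβ))) Hv) Hv'). Qed.

Lemma totalE Γ f c β : Γ ⊢ total f c -> Γ ⊢ β ∈ c -> Γ ⊢ ∃' pair_in f.+1 β.+1 0.
Proof. by move=> H Hβ; exact: (BAllE H Hβ). Qed.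

Lemma level_fun_total Γ f a c : Γ ⊢ level_fun P f a -> Γ ⊢ subset c a -> Γ ⊢ total f c.
Proof.
move=> H S; have {H}[/andE[_ H] _] := (AndE1 H, I).
bi β => Hβ; have E := BAllE H (subsetE S Hβ); exd E u => /andE[Hu _].
by exi u.
Qed.

Lemma level_funE Γ f a β u x : Γ ⊢ level_fun P f a -> Γ ⊢ β ∈ a -> Γ ⊢ pair_in f β u ->
  (Γ ⊢ x ∈ u) <-> (Γ ⊢ in_level P f β x).
Proof.
move=> /andE[_ H] Hβ Hu; apply: iffE.
exact: (AllE x (ImpE (AllE u (BAllE H Hβ)) Hu)).
Qed.

Lemma in_levelI Γ f c x β u : Γ ⊢ β ∈ c -> Γ ⊢ pair_in f β u -> Γ ⊢ sub_prod P x u ->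
  Γ ⊢ in_level P f c x.
Proof. by move=> H1 H2 H3; bexi β => //; exi u; apply: AndI. Qed.

Lemma in_level_mono Γ f c c' x : Γ ⊢ subset c c' -> Γ ⊢ in_level P f c x -> Γ ⊢ in_level P f c' x.
Proof.
move=> S H; exd H β => Hβ H; exd H v => /andE[Hv Hx].
exact: in_levelI (subsetE S Hβ) Hv Hx.
Qed.

Lemma in_level_transfer Γ f f' c x : Γ ⊢ agree f f' c -> Γ ⊢ total f' c ->
  Γ ⊢ in_level P f c x -> Γ ⊢ in_level P f' c x.
Proof.
move=> HA HT H; exd H β => Hβ H; exd H v => /andE[Hv Hx].
have E := totalE HT Hβ; exd E v' => Hv'.
apply: (in_levelI Hβ Hv').
exact: (EquE (φ := sub_prod (P↑1) x.+1 0) (agreeE HA Hβ Hv Hv') Hx).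
Qed.

Lemma agree_sym Γ f f' c : Γ ⊢ agree f f' c -> Γ ⊢ agree f' f c.
Proof.
by move=> H; bi β => Hβ; ai v; ai v'; ii => Hv; ii => Hv'; apply/eq_sym/(agreeE H Hβ).
Qed.

Lemma subset_refl Γ a : Γ ⊢ subset a a.
Proof. by bi n. Qed.

Lemma trans_subset Γ a b : Γ ⊢ is_trans a -> Γ ⊢ b ∈ a -> Γ ⊢ subset b a.
Proof. by move=> T H; bi n => Hn; exact: trans_mem T Hn H. Qed.

Lemma in_level_agree Γ f a f' a' c x : Γ ⊢ level_fun P f a -> Γ ⊢ level_fun P f' a' ->
  Γ ⊢ subset c a -> Γ ⊢ subset c a' -> Γ ⊢ agree f f' c ->
  (Γ ⊢ in_level P f c x) <-> (Γ ⊢ in_level P f' c x).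
Proof.
move=> H H' S S' C; split; apply: in_level_transfer.
- exact: C.
- exact: (level_fun_total H' S').
- exact: (agree_sym C).
- exact: (level_fun_total H S).
Qed.

Lemma level_fun_unique Γ f a f' a' γ u u' :
  Γ ⊢ level_fun P f a -> Γ ⊢ level_fun P f' a' -> Γ ⊢ is_trans a -> Γ ⊢ is_trans a' ->
  Γ ⊢ γ ∈ a -> Γ ⊢ γ ∈ a' -> Γ ⊢ pair_in f γ u -> Γ ⊢ pair_in f' γ u' -> Γ ⊢ u ≈ u'.
Proof.
move=> L L' T T' Hγ Hγ' Hu Hu'.
suff H : Γ ⊢ ∀' ∀' γ.+2 ∈ a.+2 ⇒ γ.+2 ∈ a'.+2 ⇒ pair_in f.+2 γ.+2 1 ⇒ pair_in f'.+2 γ.+2 0 ⇒ 1 ≈ 0.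
  exact: (ImpE (ImpE (ImpE (ImpE (AllE u' (AllE u H)) Hγ) Hγ') Hu) Hu').
clear u u' Hγ Hγ' Hu Hu'.
apply: (@set_ind Γ (∀' ∀' 2 ∈ a.+3 ⇒ 2 ∈ a'.+3 ⇒ pair_in f.+3 2 1 ⇒ pair_in f'.+3 2 0 ⇒ 1 ≈ 0)).
move=> {}γ; world=> IH; rs; ai u; ai u'; ii => Hγ; ii => Hγ'; ii => Hu; ii => Hu'.
have C : Γ ⊢ agree f f' γ.
  bi β => Hβ; ai v; ai v'; ii=> Hv; ii => Hv'.
  exact: (ImpE (ImpE (ImpE (ImpE (AllE v' (AllE v (BAllE IH Hβ)))
    (trans_mem T Hβ Hγ)) (trans_mem T' Hβ Hγ')) Hv) Hv').
apply: set_ext => x; world.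
by rewrite (level_funE x L Hγ Hu) (level_funE x L' Hγ' Hu');
  apply: (in_level_agree x L L' (trans_subset T Hγ) (trans_subset T' Hγ')).
Qed.

Lemma in_level_same Γ f a f' a' c x : Γ ⊢ level_fun P f a -> Γ ⊢ level_fun P f' a' ->
  Γ ⊢ is_trans a -> Γ ⊢ is_trans a' -> Γ ⊢ subset c a -> Γ ⊢ subset c a' ->
  (Γ ⊢ in_level P f c x) <-> (Γ ⊢ in_level P f' c x).
Proof.
move=> H H' T T' S S'; apply: (in_level_agree x H H' S S').
bi β => Hβ; ai v; ai v'; ii => Hv; ii => Hv'.
exact: (level_fun_unique H H' T T' (subsetE S Hβ) (subsetE S' Hβ) Hv Hv').
Qed.

(** The members of such a level are subsets of a fixed set of pairs, so the power set
    of the latter bounds the Separation. *)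
Lemma level_set Γ g c : Γ ⊢ ∃' ∀' 0 ∈ 1 ⇔ in_level (P↑2) g.+2 c.+2 0.
Proof.
have E := field_bound_ex Γ g; exd E D => HD.
have E := union_ex Γ D; exd E V => HV.
have E := has_pairs_ex Γ A V; exd E W => HW.
have E := pow_ex Γ W; exd E M => HM.
apply: (@separate Γ (∃[c.+1] ∃[D.+2] pair_in g.+3 1 0 ∧ sub_prod (P↑3) 2 0) M) => //; world => u Hu.
exi u; ai x; apply: iffI; world; split.
- move=> /(sepE _ Hu)[_]; rs => H; exd H β => Hβ H; exd H v => Hv /andE[H1 H2].
  exact: in_levelI Hβ H1 H2.
- move=> H; exd H β => Hβ H; exd H v => /andE[Hv Hx].
  have [_ Dv] := field_boundE HD Hv.
  apply/(sepE _ Hu); split; last by rs; bexi β => //; bexi v => //; apply: AndI.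
  apply/(powE _ HM); bi w => Hw; have E := BAllE Hx Hw; exd E e => He E; exd E d => Hd Hp.
  exact: has_pairsE HW He (unionI HV Hd Dv) Hp.
Qed.

Lemma is_levelE Γ β u χ : Γ ⊢ is_level P β u ->
  (forall Δ, sub Γ Δ -> forall g, Δ ⊢ level_fun P g β ->
     (Δ ⊢ ∀' 0 ∈ u.+1 ⇔ in_level (P↑1) g.+1 β.+1 0) -> Δ ⊢ χ) -> Γ ⊢ χ.
Proof. by move=> H K; apply: (exE H) => Δ s g; rs => /andE[]; exact: K. Qed.

Lemma is_level_uniq Γ β u u' : Γ ⊢ is_trans β -> Γ ⊢ is_level P β u -> Γ ⊢ is_level P β u' ->
  Γ ⊢ u ≈ u'.
Proof.
move=> T H H'; apply: (is_levelE H); world; move=> g L Hu.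
apply: (is_levelE H'); world; move=> g' L' Hu'.
apply: set_ext => x; world; rewrite (setE x Hu) (setE x Hu').
exact: (in_level_same x L L' T T (subset_refl _ _) (subset_refl _ _)).
Qed.

Lemma level_fun_value Γ g b γ v v' : Γ ⊢ level_fun P g b -> Γ ⊢ is_ord b -> Γ ⊢ γ ∈ b ->
  Γ ⊢ pair_in g γ v -> Γ ⊢ is_level P γ v' -> Γ ⊢ v ≈ v'.
Proof.
move=> L O Hγ Hv H; apply: (is_levelE H); world; move=> g' L' Hv'.
have T := AndE1 O; have T' := AndE1 (ord_mem O Hγ).
apply: set_ext => x; world; rewrite (setE x Hv') (level_funE x L Hγ Hv).
exact: (in_level_same x L L' T T' (trans_subset T Hγ) (subset_refl _ _)).
Qed.

(** For each [β ∈ α] the induction hypothesis gives a level function on [β], hence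
    the value [V(A)_β].  The pairs of [β] and this value, collected, form the
    function on [α]; its recursion equation holds since the level functions agree
    where they are defined. *)
Lemma level_fun_ex Γ α : Γ ⊢ is_ord α -> Γ ⊢ ∃' level_fun (P↑1) 0 α.+1.
Proof.
apply: ImpE.
apply: (@set_ind Γ (is_ord 0 ⇒ ∃' level_fun (P↑2) 0 1)) => {}α; world=> IH; rs.
ii => O.
have C : Γ ⊢ ∀[α] ∃' ∃' is_pair 1 2 0 ∧ is_level (P↑3) 2 0.
  bi β => Hβ; have E := ImpE (BAllE IH Hβ) (ord_mem O Hβ); exd E g => Hg.
  have E := level_set Γ g β; exd E u => Hu.
  have E := pair_ex Γ β u; exd E p => Hp.
  by exi p; exi u; apply: AndI => //; exi g; apply: AndI.
apply: (collect C); world=> f; rs=> H1 H2.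
have F1 : Γ ⊢ ∀' ∀' pair_in f.+2 1 0 ⇒ 1 ∈ α.+2 ∧ is_level (P↑2) 1 0.
  ai β; ai u; ii => H; exd H p => Hp H.
  have E := BAllE H2 Hp; exd E β' => Hβ' E; exd E u' => /andE[H' Hl].
  have [E1 E2] := pair_inj H' H.
  apply: AndI; first exact: eq_mem E1 Hβ'.
  apply: (EquE (φ := is_level (P↑1) β.+1 0) E2).
  exact: (EquE (φ := is_level (P↑1) 0 u'.+1) E1).
have F2 : Γ ⊢ total f α.
  bi β => Hβ; have E := BAllE H1 Hβ; exd E p => Hp E; exd E u => /andE[H _].
  by exi u; apply: pair_inI Hp H.
exi f; apply: AndI; first (apply: AndI; first bi p).
- move=> Hp; have E := BAllE H2 Hp; exd E β => Hβ E; exd E u => /andE[H _].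
  by bexi β => //; exi u.
- bi β => Hβ; have E := totalE F2 Hβ; exd E u => Hu; exi u; apply: AndI => //.
  ai v; ii => Hv; have /andE[_ Lu] := ImpE (AllE u (AllE β F1)) Hu.
  have /andE[_ Lv] := ImpE (AllE v (AllE β F1)) Hv.
  exact: is_level_uniq (AndE1 (ord_mem O Hβ)) Lv Lu.
- bi β => Hβ; ai u; ii => Hu; ai x.
  have /andE[_ Lu] := ImpE (AllE u (AllE β F1)) Hu.
  apply: (is_levelE Lu); world; move=> g L Hx; apply: iffI; world.
  have E : Γ ⊢ agree g f β.
    bi γ => Hγ; ai v; ai v'; ii => Hv; ii => Hv'.
    have /andE[_ Lv'] := ImpE (AllE v' (AllE γ F1)) Hv'.
    exact: level_fun_value L (ord_mem O Hβ) Hγ Hv Lv'.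
  have S := trans_subset (AndE1 O) Hβ.
  have T' : Γ ⊢ total f β by bi γ => Hγ; apply: (totalE F2); apply: subsetE S Hγ.
  rewrite (setE x Hx); split; apply: in_level_transfer => //; first exact: agree_sym.
  exact: level_fun_total L (subset_refl _ _).
Qed.

(** If [β] is the union of collected ordinals at which the second components of [h]
    appear, then these components belong to [V(A)_β], so [h] appears at [β + 1]. *)
Lemma in_V_intro Γ h : Γ ⊢ ∀[h] ∃[A.+1] ∃' is_pair 2 1 0 ∧ in_V (P↑3) 0 -> Γ ⊢ in_V P h.
Proof.
move=> H.
have C : Γ ⊢ ∀[h] ∃' is_ord 0 ∧
    ∃' level_fun (P↑3) 0 1 ∧ ∃[A.+3] ∃' is_pair 4 1 0 ∧ in_level (P↑5) 2 3 0.
  bi w => Hw; have E := BAllE H Hw; exd E e => He E; exd E g => /andE[Hp E].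
  exd E α => /andE[Hα E]; exd E f => /andE[Hf Hg].
  exi α; apply: AndI => //; exi f; apply: AndI => //; bexi e => //; exi g; exact: AndI.
apply: (collect C); world=> D; rs=> H1 H2.
have E := union_ex Γ D; exd E β => Hβ.
have E := adj_ex Γ β β; exd E α => Hα.
have Oβ : Γ ⊢ is_ord β.
  by apply: (ord_union Hβ); bi γ => Hγ; have E := BAllE H2 Hγ; exd E w => _ /andE[].
have Oα := ord_succ Oβ Hα.
have E := level_fun_ex Oα; exd E f => Hf.
have S : Γ ⊢ subset β α by bi γ => /(adj_l Hα).
have E := totalE (level_fun_total Hf (subset_refl _ _)) (adj_r Hα); exd E u => Hu.
exi α; apply: AndI => //; exi f; apply: AndI => //; apply: (in_levelI (adj_r Hα) Hu).
bi w => Hw; have E := BAllE H1 Hw; exd E γ => Hγ /andE[Oγ E]; exd E f' => /andE[Hf' E].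
exd E e => He E; exd E g => /andE[Hp Hg].
bexi e => //; bexi g => //.
apply/(level_funE g Hf (adj_r Hα) Hu).
have Sγ : Γ ⊢ subset γ β by bi δ => Hδ; exact: unionI Hβ Hδ Hγ.
apply: (in_level_mono Sγ).
apply/(in_level_same g Hf' Hf (AndE1 Oγ) (AndE1 Oα) (subset_refl _ _)) => //.
by bi δ => Hδ; apply: subsetE S (subsetE Sγ Hδ).
Qed.

(** * Codes of arbitrary sets *)

Lemma canonical_V Γ e B c z : Γ ⊢ canonical P e B -> Γ ⊢ pair_in B c z -> Γ ⊢ in_V P c.
Proof. by move=> H Hc; have /andE[] := ImpE (AllE z (AllE c H)) Hc. Qed.

Lemma canonical_tag Γ e B c z f d : Γ ⊢ canonical P e B -> Γ ⊢ pair_in B c z ->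
  Γ ⊢ pair_in c f d -> Γ ⊢ e ≈ f.
Proof.
move=> H Hc Hd; have /andE[_ K] := ImpE (AllE z (AllE c H)) Hc.
exd Hd w => Hw Hd; have E := BAllE K Hw; exd E m => Hm.
by case: (pair_inj Hm Hd).
Qed.

Lemma coding_union Γ e U D : Γ ⊢ is_union U D -> Γ ⊢ ∀[D] coding (P↑1) e.+1 0 -> Γ ⊢ coding P e U.
Proof.
move=> HU HD; apply: AndI.
  by apply: (decoding_union HU); bi B => HB; exact: AndE1 (BAllE HD HB).
ai c; ai z; ii => H; apply: (pair_in_union HU H); world; move=> B HB {}H.
exact: (ImpE (AllE z (AllE c (AndE2 (BAllE HD HB)))) H).
Qed.

(** With [B] a coding of all [y ∈ z], obtained by Collection, the code of [z] is the
    set of the [⟨e, g⟩] such that [B] relates [g] to some [y ∈ z]. *)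
Lemma coding_ex Γ e z : Γ ⊢ e ∈ A -> Γ ⊢ ∃' ∃' coding (P↑2) e.+2 0 ∧ pair_in 0 1 z.+2.
Proof.
move=> He.
apply: (@set_ind Γ (∃' ∃' coding (P↑3) e.+3 0 ∧ pair_in 0 1 2)) => {}z; world=> IH; rs.
have C : Γ ⊢ ∀[z] ∃' coding (P↑2) e.+2 0 ∧ ∃' pair_in 1 0 2.
  bi y => Hy; have E := BAllE IH Hy; exd E h => E; exd E B => /andE[H1 H2].
  by exi B; apply: AndI => //; exi h.
apply: (collect C); world=> S; rs=> H1 H2.
have E := union_ex Γ S; exd E B => HB.
have CB : Γ ⊢ coding P e B.
  by apply: (coding_union HB); bi B' => Hb; have E := BAllE H2 Hb; exd E d => _ /andE[].
have E := field_bound_ex Γ B; exd E F => HF.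
have E := has_pairs_ex Γ A F; exd E W => HW.
apply: (@separate Γ (∃[z.+1] ∃[F.+2] pair_in B.+3 0 1 ∧ is_pair 2 e.+3 0) W) => //; world=> h Hh.
have E := pair_ex Γ h z; exd E p => Hp.
have E := adj_ex Γ B p; exd E B' => HB'.
have [DB KB] := (AndE1 CB, AndE2 CB).
exi h; exi B'; apply: AndI; last exact: pair_inI (adj_r HB') Hp.
apply: AndI.
- apply: (decoding_adj DB _ Hp HB'); apply: AndI.
  + ai f; ai d; ii => H; exd H w => /(sepE _ Hh)[_ H] Hw; move: H; rs => H.
    exd H y => Hy H; exd H g => Hg /andE[H Hw'].
    bexi y => //; have [_ E] := pair_inj Hw' Hw.
    exact: (EquE (φ := pair_in B.+1 0 y.+1) E H).
  + bi y => Hy; have E := BAllE H1 Hy; exd E B0 => Hb0 /andE[_ E]; exd E g => Hg.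
    have {}Hg := pair_in_sub (union_subset HB Hb0) Hg.
    have E := pair_ex Γ e g; exd E w => Hw.
    exi e; exi g; apply: AndI => //; apply: (pair_inI _ Hw).
    have [Fg _] := field_boundE HF Hg.
    apply/(sepE _ Hh); split; first exact: has_pairsE HW He Fg Hw.
    by rs; bexi y => //; bexi g => //; apply: AndI.
- ai c; ai y; ii => H; have {H}E := pair_in_adj HB' Hp H; ord E => H.
    exact: (ImpE (AllE y (AllE c KB)) H).
  have {H}[E1 _] := (AndE1 H, I).
  have S1 : Γ ⊢ ∀[h] ∃' is_pair 1 e.+2 0 ∧ in_V (P↑2) 0.
    bi w => /(sepE _ Hh)[_]; rs => H; exd H y' => Hy' H; exd H g => Hg /andE[H Hw'].
    by exi g; apply: AndI => //; apply: canonical_V KB H.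
  apply: (EquE (φ := in_V (P↑1) 0 ∧ ∀[0] ∃' is_pair 1 e.+3 0) E1); rs; apply: AndI.
    apply: in_V_intro; bi w => Hw; bexi e => //; exact: (BAllE S1 Hw).
  by bi w => Hw; have E := BAllE S1 Hw; exd E g => /andE[Hg _]; exi g.
Qed.

(** * Realizability of equality as a greatest fixed point *)

Lemma let_appI Γ e f r φ : Γ ⊢ r ∈ A -> Γ ⊢ app P e f r -> Γ ⊢ subst1 r φ -> Γ ⊢ let_app P e f φ.
Proof. by move=> Hr H1 H2; apply: (BExI Hr); apply: AndI. Qed.

Lemma let_appE Γ e f φ χ : Γ ⊢ let_app P e f φ ->
  (forall Δ, sub Γ Δ -> forall r, Δ ⊢ r ∈ A -> Δ ⊢ app P e f r -> Δ ⊢ subst1 r φ -> Δ ⊢ χ) -> Γ ⊢ χ.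
Proof. by move=> H K; apply: (bexE H) => Δ s r Hr H'; exact: (K Δ s r Hr (AndE1 H') (AndE2 H')). Qed.

Lemma rmem_inI Γ T R e a b d r0 r1 : Γ ⊢ d ∈ T -> Γ ⊢ r0 ∈ A -> Γ ⊢ app P q0 e r0 ->
  Γ ⊢ pair_in b r0 d -> Γ ⊢ r1 ∈ A -> Γ ⊢ app P q1 e r1 -> Γ ⊢ triple_in R r1 a d ->
  Γ ⊢ rmem_in P T R e a b.
Proof.
move=> Hd H0 A0 Hb H1 A1 HR; bexi d => //.
by apply: AndI; [apply: let_appI H0 A0 _|apply: let_appI H1 A1 _].
Qed.

Lemma rmem_inE Γ T R e a b χ : Γ ⊢ rmem_in P T R e a b ->
  (forall Δ, sub Γ Δ -> forall d r0 r1, Δ ⊢ d ∈ T -> Δ ⊢ r0 ∈ A -> Δ ⊢ app P q0 e r0 ->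
    Δ ⊢ pair_in b r0 d -> Δ ⊢ r1 ∈ A -> Δ ⊢ app P q1 e r1 -> Δ ⊢ triple_in R r1 a d -> Δ ⊢ χ) ->
  Γ ⊢ χ.
Proof.
move=> H K; apply: (bexE H) => Δ s d Hd; rs => /andE[H1 H2].
apply: (let_appE H1) => Δ1 s1 r0 H0 A0 P0.
apply: (let_appE (weak s1 H2)) => Δ2 s2 r1 H0' A1 P1.
have s12 := sub_trans s1 s2.
exact: (K _ (sub_trans s s12) d r0 r1 (weak s12 Hd) (weak s2 H0) (weak s2 A0) (weak s2 P0)).
Qed.

Lemma rsub_inE Γ T q R e a b f d χ : Γ ⊢ rsub_in P T q R e a b -> Γ ⊢ f ∈ T -> Γ ⊢ d ∈ T ->
  Γ ⊢ pair_in a f d ->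
  (forall Δ, sub Γ Δ -> forall u v, Δ ⊢ u ∈ A -> Δ ⊢ app P q e u -> Δ ⊢ v ∈ A ->
    Δ ⊢ app P u f v -> Δ ⊢ rmem_in P T R v d b -> Δ ⊢ χ) -> Γ ⊢ χ.
Proof.
move=> H Hf Hd Hp K; have H1 := ImpE (BAllE (BAllE H Hf) Hd) Hp.
apply: (let_appE (φ := let_app (P↑1) 0 f.+1 (rmem_in (P↑2) T.+2 R.+2 0 d.+2 b.+2)) H1).
move=> Δ s u Hu Au H2.
apply: (let_appE (φ := rmem_in (P↑1) T.+1 R.+1 0 d.+1 b.+1) H2) => Δ' s' v Hv Av H3.
exact: (K _ (sub_trans s s') u v (weak s' Hu) (weak s' Au) Hv Av H3).
Qed.

Lemma rsub_inI Γ T q R e a b :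
  (forall f d Δ, sub Γ Δ -> Δ ⊢ f ∈ T -> Δ ⊢ d ∈ T -> Δ ⊢ pair_in a f d ->
    Δ ⊢ let_app P q e (let_app (P↑1) 0 f.+1 (rmem_in (P↑2) T.+2 R.+2 0 d.+2 b.+2))) ->
  Γ ⊢ rsub_in P T q R e a b.
Proof.
move=> H; apply: ballI => f Δ s Hf; apply: ballI => d Δ' s' Hd; apply: impI => Δ2 s2 Hp.
by apply: H; [exact: (sub_trans s (sub_trans s' s2))|exact: weak s2 (weak s' Hf)|exact: weak s2 Hd|].
Qed.

Lemma let_app2I Γ q e f u v φ : Γ ⊢ u ∈ A -> Γ ⊢ app P q e u -> Γ ⊢ v ∈ A -> Γ ⊢ app P u f v ->
  Γ ⊢ subst1 v (ren (up (scons u id)) φ) -> Γ ⊢ let_app P q e (let_app (P↑1) 0 f.+1 φ).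
Proof.
by move=> Hu Au Hv Av H; apply: (let_appI Hu Au); apply: (let_appI Hv Av).
Qed.

Lemma belowE Γ T R R' e a b : Γ ⊢ below P T R R' -> Γ ⊢ e ∈ A -> Γ ⊢ a ∈ T -> Γ ⊢ b ∈ T ->
  Γ ⊢ triple_in R e a b -> Γ ⊢ triple_in R' e a b.
Proof. by move=> H He Ha Hb; exact: ImpE (BAllE (BAllE (BAllE H He) Ha) Hb). Qed.

Lemma rsub_in_mono Γ T q R R' e a b : Γ ⊢ below P T R R' -> Γ ⊢ rsub_in P T q R e a b ->
  Γ ⊢ rsub_in P T q R' e a b.
Proof.
move=> S H; apply: rsub_inI => f d; world=> Hf Hd Hp.
apply: (rsub_inE H Hf Hd Hp); world; move=> u v Hu Au Hv Av M.
apply: (let_app2I Hu Au Hv Av); rs.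
apply: (rmem_inE M); world; move=> d' r0 r1 Hd' H0 A0 Hb H1 A1 HR.
exact: rmem_inI Hd' H0 A0 Hb H1 A1 (belowE S H1 Hd Hd' HR).
Qed.

Lemma req_in_mono Γ T R R' e a b : Γ ⊢ below P T R R' -> Γ ⊢ req_in P T R e a b ->
  Γ ⊢ req_in P T R' e a b.
Proof. by move=> S /andE[H1 H2]; apply: AndI; apply: rsub_in_mono S _. Qed.

Lemma post_fixedE Γ T R e a b : Γ ⊢ post_fixed P T R -> Γ ⊢ e ∈ A -> Γ ⊢ a ∈ T -> Γ ⊢ b ∈ T ->
  Γ ⊢ triple_in R e a b -> Γ ⊢ req_in P T R e a b.
Proof. by move=> H He Ha Hb; exact: ImpE (BAllE (BAllE (BAllE H He) Ha) Hb). Qed.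

(** Knaster-Tarski: [R] is the union of all post-fixed relations.  It is post-fixed
    since the operator is monotone, hence so is its image [R'] under the operator,
    and therefore [R'] lies below [R]. *)
Lemma gfp_ex Γ W T : Γ ⊢ has_triples W A T ->
  Γ ⊢ ∃' fixed_pt (P↑1) T.+1 0 ∧ (∀' subset 0 W.+2 ⇒ post_fixed (P↑2) T.+2 0 ⇒ below (P↑2) T.+2 0 1).
Proof.
move=> HW; have E := pow_ex Γ W; exd E Q => HQ.
apply: (@triple_sep Γ W A T (∃[Q.+3] post_fixed (P↑4) T.+4 0 ∧ triple_in 0 3 2 1)) => //.
world; move=> R SR HR.
(* The following facts say that [R] is above all post-fixed relations and post-fixed itself. *)
have max : Γ ⊢ ∀' subset 0 W.+1 ⇒ post_fixed (P↑1) T.+1 0 ⇒ below (P↑1) T.+1 0 R.+1.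
  ai S; ii => SS; ii => HS; bi e => He; bi a => Ha; bi b => Hb; ii => H.
  apply/(triple_sepE HR He Ha Hb); rewrite /env3; rs; bexi S; first exact/(powE _ HQ).
  exact: AndI.
have post : Γ ⊢ post_fixed P T R.
  bi e => He; bi a => Ha; bi b => Hb; ii => /(triple_sepE HR He Ha Hb); rewrite /env3; rs => H.
  exd H S => HS /andE[PS H]; move: HS => /(powE _ HQ) HS.
  exact: req_in_mono (ImpE (ImpE (AllE S max) HS) PS) (post_fixedE PS He Ha Hb H).
apply: (@triple_sep Γ W A T (req_in (P↑3) T.+3 R.+3 2 1 0)) => //.
world; move=> R' SR' HR'.
have post' : Γ ⊢ below P T R R'.
  bi e => He; bi a => Ha; bi b => Hb; ii => H.
  by apply/(triple_sepE HR' He Ha Hb); rewrite /env3; rs; exact: post_fixedE post He Ha Hb H.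
have post2 : Γ ⊢ post_fixed P T R'.
  bi e => He; bi a => Ha; bi b => Hb; ii => /(triple_sepE HR' He Ha Hb); rewrite /env3; rs.
  exact: req_in_mono post'.
have pre := ImpE (ImpE (AllE R' max) SR') post2.
exi R; apply: AndI => //; bi e => He; bi a => Ha; bi b => Hb; apply: iffI; world; split=> H.
  exact: post_fixedE post He Ha Hb H.
apply: (belowE pre He Ha Hb); apply/(triple_sepE HR' He Ha Hb).
by rewrite /env3; rs.
Qed.

Lemma fixed_ptE Γ T R e a b : Γ ⊢ fixed_pt P T R -> Γ ⊢ e ∈ A -> Γ ⊢ a ∈ T -> Γ ⊢ b ∈ T ->
  (Γ ⊢ triple_in R e a b) <-> (Γ ⊢ req_in P T R e a b).
Proof. by move=> H He Ha Hb; apply: iffE; exact: BAllE (BAllE (BAllE H He) Ha) Hb. Qed.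

Lemma rmem_stepE Γ T R e a b : Γ ⊢ is_trans T -> Γ ⊢ b ∈ T ->
  (Γ ⊢ rmem_step P R e a b) <-> (Γ ⊢ rmem_in P T R e a b).
Proof.
move=> HT Hb; split=> H.
- exd H d => /andE[H1 H2]; apply: (let_appE H1); world; move=> r0 H0 A0 K.
  apply: (let_appE H2); world; move=> r1 H1' A1 K1.
  have [_ Hd] := trans_pair_in HT Hb K.
  exact: rmem_inI Hd H0 A0 K H1' A1 K1.
- exd H d => Hd H; exi d; exact: H.
Qed.

Lemma rsub_stepE Γ T q R e a b : Γ ⊢ is_trans T -> Γ ⊢ a ∈ T -> Γ ⊢ b ∈ T ->
  (Γ ⊢ rsub_step P q R e a b) <-> (Γ ⊢ rsub_in P T q R e a b).
Proof.
move=> HT Ha Hb; split=> H.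
- apply: rsub_inI => f d; world=> Hf Hd Hp.
  have H1 := ImpE (AllE d (AllE f H)) Hp.
  apply: (let_appE (φ := let_app (P↑1) 0 f.+1 (rmem_step (P↑2) R.+2 0 d.+2 b.+2)) H1).
  world; move=> u Hu Au H2.
  apply: (let_appE (φ := rmem_step (P↑1) R.+1 0 d.+1 b.+1) H2); world; move=> v Hv Av H3.
  by apply: (let_app2I Hu Au Hv Av); rs; apply/rmem_stepE.
- ai f; ai d; ii => Hp; have [Hf Hd] := trans_pair_in HT Ha Hp.
  apply: (rsub_inE H Hf Hd Hp); world; move=> u v Hu Au Hv Av M.
  by apply: (let_app2I (φ := rmem_step (P↑2) R.+2 0 d.+2 b.+2) Hu Au Hv Av); rs;
    apply/(rmem_stepE _ _ _ HT).
Qed.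

(** The pairs in members of the transitive set [T] have their components in [T], so
    the bounds by [T] change nothing. *)
Lemma req_stepE Γ T R e a b : Γ ⊢ is_trans T -> Γ ⊢ a ∈ T -> Γ ⊢ b ∈ T ->
  (Γ ⊢ req_step P R e a b) <-> (Γ ⊢ req_in P T R e a b).
Proof.
move=> HT Ha Hb; rewrite /req_step /req_in.
split=> /andE[/(rsub_stepE _ _ _ HT Ha Hb) H1 /(rsub_stepE _ _ _ HT Hb Ha) H2]; exact: AndI.
Qed.

Lemma approxP Γ T R : Γ ⊢ is_trans T -> (Γ ⊢ approx P T R) <-> (Γ ⊢ fixed_pt P T R).
Proof.
move=> HT; split=> [/andE[_ H]|H]; last apply: (AndI HT).
- bi e => He; bi a => Ha; bi b => Hb; apply: iffI; world; rewrite -(req_stepE _ _ HT Ha Hb).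
  exact: iffE (BAllE (BAllE (BAllE H He) Ha) Hb).
- bi e => He; bi a => Ha; bi b => Hb; apply: iffI; world; rewrite (req_stepE _ _ HT Ha Hb).
  exact: iffE (BAllE (BAllE (BAllE H He) Ha) Hb).
Qed.

(** The triples [⟨e, a, b⟩] with [a] and [b] coding a common set form a post-fixed
    relation: if [⟨e, d⟩ ∈ a] and [d] codes [y], then [b] has a member [⟨e, d'⟩]
    where [d'] codes [y] too, so [v] realizes [d ∈ b]. *)
Lemma approx_ex Γ e u v T B : Γ ⊢ self_tag P e u v -> Γ ⊢ is_trans T -> Γ ⊢ coding P e B ->
  Γ ⊢ ∃' approx (P↑1) T.+1 0 ∧
     (∀[T.+1] ∀[T.+2] (∃' pair_in B.+4 2 0 ∧ pair_in B.+4 1 0) ⇒ triple_in 2 e.+3 1 0).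
Proof.
move=> /andE[He /andE[Hu /andE[Hv /andE[A1 /andE[A2 /andE[A3 /andE[A4 A5]]]]]]] HT /andE[DB KB].
have E := has_triples_ex Γ A T; exd E W => HW.
have E := gfp_ex HW; exd E R => /andE[FR max].
have E := field_bound_ex Γ B; exd E F => HF.
apply: (@triple_sep Γ W A T (2 ≈ e.+3 ∧ ∃[F.+3] pair_in B.+4 2 0 ∧ pair_in B.+4 1 0)) => //.
world; move=> S SS HS.
have R0 : Γ ⊢ ∀[T] ∀[T.+1] (∃[F.+2] pair_in B.+3 2 0 ∧ pair_in B.+3 1 0) ⇒ triple_in S.+2 e.+2 1 0.
  bi a => Ha; bi b => Hb; ii => H; apply/(triple_sepE HS He Ha Hb); rewrite /env3; rs.
  by apply: AndI => //; apply: EquI.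
(* Both projections of [e] are [u], so one inclusion of codes serves for both. *)
have half : Γ ⊢ ∀[T] ∀[T.+1] (∃[F.+2] pair_in B.+3 2 0 ∧ pair_in B.+3 1 0) ⇒
    rsub_in (P↑2) T.+2 q0.+2 S.+2 e.+2 1 0 ∧ rsub_in (P↑2) T.+2 q1.+2 S.+2 e.+2 1 0.
  bi a => Ha; bi b => Hb; ii => H; exd H z => Hz /andE[Za Zb].
  have K : Γ ⊢ ∀' ∀' pair_in a.+2 1 0 ⇒ app (P↑2) u.+2 1 v.+2 ∧ rmem_in (P↑2) T.+2 S.+2 v.+2 0 b.+2.
    ai f; ai d; ii => Hp; have Ef := canonical_tag KB Za Hp; apply: AndI.
      exact: (EquE (φ := app (P↑1) u.+1 0 v.+1) Ef A3).
    have E := decode_fwd DB Za Hp; exd E y => Hy Yd.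
    have E := decode_bwd DB Zb Hy; exd E f' => E; exd E d' => /andE[Hp' Yd'].
    have [_ Hd] := trans_pair_in HT Ha Hp.
    have [_ Hd'] := trans_pair_in HT Hb Hp'.
    have Ef' := eq_sym (canonical_tag KB Zb Hp').
    have {}Hp' := EquE (φ := pair_in b.+1 0 d'.+1) Ef' Hp'.
    apply: (rmem_inI Hd' He A4 Hp' He A5).
    apply: (ImpE (BAllE (BAllE R0 Hd) Hd')); rs; bexi y; last exact: AndI.
    by case: (field_boundE HF Yd).
  apply: AndI; apply: rsub_inI => f d; world=> Hf Hd Hp;
    have /andE[K1 K2] := ImpE (AllE d (AllE f K)) Hp.
  - apply: (let_app2I Hu A1 Hv K1); rs; exact: K2.
  - apply: (let_app2I Hu A2 Hv K1); rs; exact: K2.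
have post : Γ ⊢ post_fixed P T S.
  bi e' => He'; bi a => Ha; bi b => Hb; ii => /(triple_sepE HS He' Ha Hb).
  rewrite /env3; rs => /andE[Ee H].
  have H' : Γ ⊢ ∃[F] pair_in B.+1 b.+1 0 ∧ pair_in B.+1 a.+1 0.
    by exd H z => Hz /andE[H1 H2]; bexi z => //; apply: AndI.
  have [H1 _] := (AndE1 (ImpE (BAllE (BAllE half Ha) Hb) H), I).
  have [H2 _] := (AndE2 (ImpE (BAllE (BAllE half Hb) Ha) H'), I).
  apply: (EquE (φ := req_in (P↑1) T.+1 S.+1 0 a.+1 b.+1) (eq_sym Ee)).
  exact: AndI H1 H2.
have HSR := ImpE (ImpE (AllE S max) SS) post.
exi R; apply: AndI; first exact/approxP.
bi a => Ha; bi b => Hb; ii => H; apply: (belowE HSR He Ha Hb).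
apply: (ImpE (BAllE (BAllE R0 Ha) Hb)); exd H z => /andE[H1 H2]; rs; bexi z; last exact: AndI.
by case: (field_boundE HF H1).
Qed.

(** * Realized equality is reflected by decoding *)

Lemma rsub_in_step Γ T R q e c d f c' : Γ ⊢ is_trans T -> Γ ⊢ c ∈ T ->
  Γ ⊢ rsub_in P T q R e c d -> Γ ⊢ pair_in c f c' ->
  Γ ⊢ ∃' ∃' pair_in d.+2 1 0 ∧ eq_realized A.+2 R.+2 c'.+2 0.
Proof.
move=> HT Hc H Hp; have [Hf Hc'] := trans_pair_in HT Hc Hp.
apply: (rsub_inE H Hf Hc' Hp); world; move=> u v _ _ _ _ M.
apply: (rmem_inE M); world; move=> d' r0 r1 _ _ _ Hd' H1 _ HR.
by exi r0; exi d'; apply: AndI => //; bexi r1 => //; apply: OrI1.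
Qed.

Lemma eq_realized_step Γ T R c d f c' :
  Γ ⊢ is_trans T -> Γ ⊢ fixed_pt P T R -> Γ ⊢ c ∈ T -> Γ ⊢ d ∈ T ->
  Γ ⊢ eq_realized A R c d -> Γ ⊢ pair_in c f c' ->
  Γ ⊢ ∃' ∃' pair_in d.+2 1 0 ∧ eq_realized A.+2 R.+2 c'.+2 0.
Proof.
move=> HT HR Hc Hd H Hp; exd H e => He E; ord E => E.
- have /andE[H _] := proj1 (fixed_ptE HR He Hc Hd) E; exact: (rsub_in_step HT Hc H Hp).
- have /andE[_ H] := proj1 (fixed_ptE HR He Hd Hc) E; exact: (rsub_in_step HT Hc H Hp).
Qed.

Lemma eq_realized_sym Γ R c d : Γ ⊢ eq_realized A R c d -> Γ ⊢ eq_realized A R d c.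
Proof. by move=> H; exd H e => He E; bexi e => //; ord E => E; [apply: OrI2|apply: OrI1]. Qed.

(** Induction on [z], using [eq_realized_step] in both directions: an element of [z]
    is decoded from a member of [c], which is realizably equal to a member of [d],
    whose decoding is an element of [z']. *)
Lemma eq_realized_decode Γ T R B B' c d z z' : Γ ⊢ is_trans T -> Γ ⊢ fixed_pt P T R ->
  Γ ⊢ decoding B -> Γ ⊢ decoding B' -> Γ ⊢ pair_in B c z -> Γ ⊢ pair_in B' d z' ->
  Γ ⊢ c ∈ T -> Γ ⊢ d ∈ T -> Γ ⊢ eq_realized A R c d -> Γ ⊢ z ≈ z'.
Proof.
move=> HT HR HB HB' Hz Hz' Hc Hd HS.
pose φ z := pair_in B.+3 1 z ⇒ pair_in B'.+3 0 2 ⇒ 1 ∈ T.+3 ⇒ 0 ∈ T.+3 ⇒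
  eq_realized A.+3 R.+3 1 0 ⇒ z ≈ 2.
suff H : Γ ⊢ ∀' ∀' ∀' φ z.+3.
  exact: (ImpE (ImpE (ImpE (ImpE (ImpE (AllE d (AllE c (AllE z' H))) Hz) Hz') Hc) Hd) HS).
rewrite {}/φ; clear z' c d Hz Hz' Hc Hd HS.
apply: (@set_ind Γ (∀' ∀' ∀' pair_in B.+4 1 3 ⇒ pair_in B'.+4 0 2 ⇒ 1 ∈ T.+4 ⇒ 0 ∈ T.+4 ⇒
  eq_realized A.+4 R.+4 1 0 ⇒ 3 ≈ 2)) => {}z; world=> IH; rs.
ai z'; ai c; ai d; ii => Hz; ii => Hz'; ii => Hc; ii => Hd; ii => HS.
have {}IH : Γ ⊢ ∀[z] ∀' ∀' ∀' pair_in B.+4 1 3 ⇒ pair_in B'.+4 0 2 ⇒ 1 ∈ T.+4 ⇒ 0 ∈ T.+4 ⇒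
  eq_realized A.+4 R.+4 1 0 ⇒ 3 ≈ 2 by exact: IH.
apply: set_ext => y; world; split=> Hy.
- have E := decode_bwd HB Hz Hy; exd E f => E; exd E c' => /andE[Hp Hy'].
  have [_ Hc'] := trans_pair_in HT Hc Hp.
  have E := eq_realized_step HT HR Hc Hd HS Hp; exd E g => E; exd E d' => /andE[Hp' HS'].
  have [_ Hd'] := trans_pair_in HT Hd Hp'.
  have E := decode_fwd HB' Hz' Hp'; exd E y' => Hyz' Hyd.
  apply: (eq_mem _ Hyz'); apply: eq_sym.
  exact: (ImpE (ImpE (ImpE (ImpE (ImpE (AllE d' (AllE c' (AllE y' (BAllE IH Hy))))
    Hy') Hyd) Hc') Hd') HS').
- have E := decode_bwd HB' Hz' Hy; exd E f => E; exd E d' => /andE[Hp Hy'].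
  have [_ Hd'] := trans_pair_in HT Hd Hp.
  have E := eq_realized_step HT HR Hd Hc (eq_realized_sym HS) Hp.
  exd E g => E; exd E c' => /andE[Hp' HS'].
  have [_ Hc'] := trans_pair_in HT Hc Hp'.
  have E := decode_fwd HB Hz Hp'; exd E y' => Hyz Hyc.
  apply: (eq_mem _ Hyz).
  exact: (ImpE (ImpE (ImpE (ImpE (ImpE (AllE d' (AllE c' (AllE y (BAllE IH Hyz))))
    Hyc) Hy') Hc') Hd') (eq_realized_sym HS')).
Qed.

(** * A tag that realizes equality *)

Lemma k_app Γ k a b : Γ ⊢ is_k P k -> Γ ⊢ a ∈ A -> Γ ⊢ b ∈ A ->
  Γ ⊢ ∃[A] app (P↑1) k.+1 a.+1 0 ∧ app (P↑1) 0 b.+1 a.+1.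
Proof. by move=> H Ha Hb; exact: (BAllE (BAllE H Ha) Hb). Qed.

Lemma s_app Γ s a b χ : Γ ⊢ is_s P s -> Γ ⊢ a ∈ A -> Γ ⊢ b ∈ A ->
  (forall Δ, sub Γ Δ -> forall r, Δ ⊢ r ∈ A ->
     (Δ ⊢ ∀[A] ∀[A.+1] app (P↑2) r.+2 1 0 ⇔
         let_app (P↑2) a.+2 1 (let_app (P↑3) b.+3 2 (app (P↑4) 1 0 2))) -> Δ ⊢ χ) -> Γ ⊢ χ.
Proof.
move=> H Ha Hb K; have {H}H := BAllE (BAllE H Ha) Hb.
apply: (let_appE (φ := let_app (P↑1) 0 b.+1 (∀[A.+2] ∀[A.+3] app (P↑4) 2 1 0 ⇔
         let_app (P↑4) a.+4 1 (let_app (P↑5) b.+4.+1 2 (app (P↑6) 1 0 2)))) H) => Δ τ sa _ _ H1.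
apply: (let_appE (φ := ∀[A.+1] ∀[A.+2] app (P↑3) 2 1 0 ⇔
         let_app (P↑3) a.+3 1 (let_app (P↑4) b.+4 2 (app (P↑5) 1 0 2))) H1) => Δ' τ' r Hr _ H2.
exact: (K _ (sub_trans τ τ') r Hr H2).
Qed.

Lemma s_val Γ a b r c x y z : Γ ⊢ ∀[A] ∀[A.+1] app (P↑2) r.+2 1 0 ⇔
    let_app (P↑2) a.+2 1 (let_app (P↑3) b.+3 2 (app (P↑4) 1 0 2)) ->
  Γ ⊢ c ∈ A -> Γ ⊢ x ∈ A -> Γ ⊢ y ∈ A -> Γ ⊢ z ∈ A ->
  Γ ⊢ app P a c x -> Γ ⊢ app P b c y -> Γ ⊢ app P x y z -> Γ ⊢ app P r c z.
Proof.
move=> H Hc Hx Hy Hz Hax Hby Hxy; apply: (ImpE (AndE2 (BAllE (BAllE H Hc) Hz))).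
by apply: (let_appI Hx Hax); apply: (let_appI Hy Hby).
Qed.

Lemma pairing_app Γ a b : Γ ⊢ is_pairing P -> Γ ⊢ a ∈ A -> Γ ⊢ b ∈ A ->
  Γ ⊢ ∃[A] ∃[A.+1] app (P↑2) pr.+2 a.+2 1 ∧ app (P↑2) 1 b.+2 0 ∧
      app (P↑2) q0.+2 0 a.+2 ∧ app (P↑2) q1.+2 0 b.+2.
Proof.
move=> H Ha Hb; have {}H := BAllE (BAllE H Ha) Hb.
apply: (let_appE (φ := let_app (P↑1) 0 b.+1 (app (P↑2) q0.+2 0 a.+2 ∧ app (P↑2) q1.+2 0 b.+2)) H).
world; move=> x Hx Ax {}H.
apply: (let_appE (φ := app (P↑1) q0.+1 0 a.+1 ∧ app (P↑1) q1.+1 0 b.+1) H); world; move=> y Hy Ay {}H.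
by bexi x => //; bexi y => //; do 2![apply: AndI => //].
Qed.

(** [u = s p (s k k)], [e = p u u] and [v = p e e]. *)
Lemma tag_ex Γ : Γ ⊢ is_pca P -> Γ ⊢ ∃' ∃' ∃' self_tag (P↑3) 2 1 0.
Proof.
move=> /andE[_ /andE[Ek /andE[Es /andE[/andE[Hpr /andE[_ /andE[_ HP]]] _]]]].
exd Ek k => Hk HK; exd Es s => Hs HS.
apply: (s_app HS Hk Hk); world; move=> i Hi Ai.
apply: (s_app HS Hpr Hi); world; move=> u Hu Au.
have E := pairing_app HP Hu Hu; exd E x => _ E; exd E e => He /andE[_ /andE[_ /andE[A1 A2]]].
have E := pairing_app HP He He; exd E y => Hy E; exd E v => Hv /andE[A3 /andE[A4 /andE[A5 A6]]].
exi e; exi u; exi v; do 3![apply: AndI => //]; do 2![apply: AndI => //]; apply: AndI; last exact: AndI.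
apply: (s_val Au He Hy He Hv A3 _ A4).
(* To compute [s k k e] as [r r'], any value [r'] of [k e] will do, after which
   [r] is chosen so that [r r'] is [e]. *)
have E := k_app HK He He; exd E r' => Hr' /andE[B1 _].
have E := k_app HK He Hr'; exd E r => Hr /andE[B2 B3].
exact: (s_val Ai He Hr Hr' He B2 B1 B3).
Qed.

(** * Realizing the failure of double complements *)

(** As [z ∈ x], the code [a] has a member [⟨e, d⟩] with [d] a code of [z].  The
    projections of [v] are the tag [e] and the realizer [e] of [c = d]; a common
    coding of both names is the union of the two given ones. *)
Lemma realizes_mem Γ e u v B1 B2 a x c z : Γ ⊢ self_tag P e u v ->
  Γ ⊢ coding P e B1 -> Γ ⊢ pair_in B1 a x -> Γ ⊢ coding P e B2 -> Γ ⊢ pair_in B2 c z ->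
  Γ ⊢ z ∈ x -> Γ ⊢ rmem P v c a.
Proof.
move=> F C1 Hx C2 Hz Hzx.
have E := decode_bwd (AndE1 C1) Hx Hzx; exd E f => E; exd E d => /andE[Hp Hd].
have {}Hp := EquE (φ := pair_in a.+1 0 d.+1) (eq_sym (canonical_tag (AndE2 C1) Hx Hp)) Hp.
have E := pairing_ex Γ B1 B2; exd E p => HBp.
have E := union_ex Γ p; exd E B => HB.
have C : Γ ⊢ coding P e B.
  apply: (coding_union HB); bi b => /(upairE _ HBp) E; ord E => /eq_sym E.
    exact: (EquE (φ := coding (P↑1) e.+1 0) E C1).
  exact: (EquE (φ := coding (P↑1) e.+1 0) E C2).
have {}Hd := pair_in_sub (union_subset HB (upairl HBp)) Hd.
have {}Hz := pair_in_sub (union_subset HB (upairr HBp)) Hz.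
have E := trans_closure2 Γ c d; exd E T => /andE[HT /andE[Tc Td]].
have E := approx_ex F HT C; exd E R => /andE[HR K].
have [He /andE[_ /andE[_ /andE[_ /andE[_ /andE[_ /andE[A1 A2]]]]]]] := (AndE1 F, AndE2 F).
exi d; apply: AndI; [apply: (let_appI He A1)|apply: (let_appI He A2)]; first exact: Hp.
exi T; exi R; do 3![apply: AndI => //].
by apply: (ImpE (BAllE (BAllE K Tc) Td)); exi z; apply: AndI.
Qed.

Lemma NDCom_realized Γ : Γ ⊢ is_pca P -> Γ ⊢ V_models P NDCom.
Proof.
move=> HP; have E := tag_ex HP; exd E e => E; exd E u => E; exd E v => F.
have [He Hv] := (AndE1 F, AndE1 (AndE2 (AndE2 F))).
have N : Γ ⊢ NDCom by apply/Ax/base_NDCom.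
exd N x => N.
have E := coding_ex x He; exd E a => E; exd E B1 => /andE[C1 Hx].
bexi e => //.
(* The realizability clauses of the formula, unfolded. *)
change (Γ ⊢ ∃' in_V (P↑1) 0 ∧ ∀' in_V (P↑2) 0 ⇒ ¬ ∃[A.+2] ∀' in_V (P↑4) 0 ⇒
  ∀[A.+4] (¬ ∃[A.+4.+1] ¬ ∃[A.+4.+2] rmem (P↑7) 0 3 6) ⇒
    let_app (P↑5) 2 0 (rmem (P↑6) 0 2 4)).
exi a; apply: AndI; first exact: canonical_V (AndE2 C1) Hx.
ai b; ii => _; ni => H; exd H f => Hf H.
have E := decodable_all Γ b; exd E Y => E; exd E D => /andE[HD HY].
have {}N : Γ ⊢ ¬ (∀' (¬ ¬ 0 ∈ x.+1) ⇒ 0 ∈ Y.+1) by exact: AllE Y N.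
apply: (negE _ N); ai z; ii => nnz.
have E := coding_ex z He; exd E c => E; exd E B2 => /andE[C2 Hz].
have {}H := BAllE (ImpE (AllE c H) (canonical_V (AndE2 C2) Hz)) He.
(* This is realizability of [¬¬ c ∈ a], for which all realizers are alike. *)
have K : Γ ⊢ ¬ ∃[A] ¬ ∃[A.+1] rmem (P↑2) 0 c.+2 a.+2.
  ni => H0; exd H0 j => _ N2; apply: (negE _ nnz); ni => Hzx; apply: (negE _ N2); bexi v => //.
  exact: realizes_mem F C1 Hx C2 Hz Hzx.
have {K}H : Γ ⊢ let_app P f e (rmem (P↑1) 0 c.+1 b.+1) by exact: ImpE H K.
exd H r => _ /andE[_ H]; exd H d => /andE[H1 H2].
exd H1 r0 => _ /andE[_ Hd]; exd H2 r1 => Hr1 /andE[_ H].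
exd H T => H; exd H R => /andE[HR /andE[Tc /andE[Td H]]].
have HT := AndE1 HR; move: HR => /(approxP _ HT) HR.
have E := decode_fwd HD HY Hd; exd E y => HyY Hdy.
have S : Γ ⊢ eq_realized A R c d by bexi r1 => //; apply: OrI1.
exact: eq_mem (eq_sym (eq_realized_decode HT HR (AndE1 C2) HD Hz Hdy Tc Td S)) HyY.
Qed.

End Realizability.

Theorem theorem7p4 :
  provable CZF_Pow_NDCom (for_all_pca (fun P => V_models P NDCom)).
Proof.
do 7![apply: allI => ?].
apply: impI => Γ _ H; exact: NDCom_realized H.
Qed.
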